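(* Let $f\colon\mathbb{D}\to\mathbb{D}$ be a parabolic holomorphic self-map with Wolff point $\tau_f\in\partial\mathbb{D}$. Fix $z_0\in\mathbb{D}$. Then $$\frac{f^n(z)-\tau_f}{f^n(z_0)-\tau_f}\to 1\qquad\text{as } n\to+\infty,$$ uniformly for $z$ in compact subsets of $\mathbb{D}$.
   Context: $\mathbb{D}=\{z\in\mathbb{C} : |z|<1\}$; $f^n$ is the $n$-th iterate of $f$. By the Wolff-Denjoy theorem, if a holomorphic $f\colon\mathbb{D}\to\mathbb{D}$ has no fixed points in $\mathbb{D}$, there is a point $\tau_f\in\partial\mathbb{D}$, called the Wolff point of $f$, such that $f^n\to\tau_f$ uniformly on compact subsets of $\mathbb{D}$; moreover $f'$ admits a non-tangential limit at $\tau_f$, denoted $f'(\tau_f)$, and $f'(\tau_f)\in(0,1]$. The map $f$ is called parabolic if it has no fixed points in $\mathbb{D}$ and $f'(\tau_f)=1$. *)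

(* Defs.v *)
From Stdlib Require Export Reals List.
From Coquelicot Require Export Coquelicot.
Open Scope R_scope.

(* A map defined on an open subset of [C] is represented by a total function
   [C -> C]; every notion below only involves its values on the relevant set. *)

Definition unit_disc (z : C) : Prop := Cmod z < 1.

Definition holomorphic_on (U : C -> Prop) (f : C -> C) : Prop :=
  forall z, U z -> ex_derive (K := C_AbsRing) (V := C_NormedModule) f z.

Definition self_map (U : C -> Prop) (f : C -> C) : Prop :=
  forall z, U z -> U (f z).

(* [compact] of the standard library only concerns subsets of [R]. *)
Definition compact_set (K : C -> Prop) : Prop :=
  forall F : (C -> Prop) -> Prop,
    (forall V, F V -> open V) ->
    (forall z, K z -> exists V, F V /\ V z) ->
    exists s : list (C -> Prop),
      (forall V, In V s -> F V) /\
      (forall z, K z -> exists V, In V s /\ V z).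

Definition cvg_unif_on (K : C -> Prop) (u : nat -> C -> C) (g : C -> C) : Prop :=
  forall eps : posreal,
    eventually (fun n => forall z, K z -> Cmod (u n z - g z)%C < eps).

Definition cvg_unif_on_compacts
    (U : C -> Prop) (u : nat -> C -> C) (g : C -> C) : Prop :=
  forall K : C -> Prop,
    compact_set K -> (forall z, K z -> U z) -> cvg_unif_on K u g.

Definition wolff_point (f : C -> C) (tau : C) : Prop :=
  Cmod tau = 1 /\
  cvg_unif_on_compacts unit_disc (fun n => Nat.iter n f) (fun _ => tau).

Definition stolz_region (tau : C) (M : R) (z : C) : Prop :=
  unit_disc z /\ Cmod (tau - z)%C < M * (1 - Cmod z).

Definition nontangential_limit (g : C -> C) (tau l : C) : Prop :=
  forall M : R, 1 < M ->
    filterlim g (within (stolz_region tau M) (locally tau)) (locally l).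

(* The Wolff point is unique, so the existential just names it. [C_derive f] is
   the complex derivative wherever [f] is complex differentiable, hence on the
   Stolz regions when [f] is holomorphic on the disc. *)
Definition parabolic (f : C -> C) : Prop :=
  (forall z, unit_disc z -> f z <> z) /\
  exists tau, wolff_point f tau /\ nontangential_limit (C_derive f) tau (RtoC 1).

(* Main.v *)
Require Import Defs.
From Stdlib Require Import Reals Lra Lia Psatz Classical ClassicalEpsilon.
From Coquelicot Require Import Coquelicot.

(** Write [z_n] for the [n]-th iterate of [z0] and [p] for the pseudo-hyperbolic
    distance of the disc. The quotient minus [1] is [(f^n z - z_n) / (z_n - tau)],
    and a bound on [p (f^n z) z_n] gives [|f^n z - z_n| <= const * (1 - |z_n|)]
    with a constant that is small when the bound is. Now [1 - |z_n| <= |tau - z_n|],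
    so the claim holds as soon as either [(1 - |z_n|) / |tau - z_n|] or
    [p (f^n z) z_n] tends to [0].

    If the first ratio does not tend to [0], infinitely many [z_n] lie in one Stolz
    region. That region is convex and [f'] tends to [1] in it, so [f] is there
    nearly a translation; comparing [z_n] with later points [z_m] of the same kind,
    for which both [z_m] and [f z_m] are close to [tau], yields
    [f z_n - z_n = o(|z_n - tau|)]. Hence [p z_(n+1) z_n], which is nonincreasing
    by Schwarz-Pick, tends to [0] ([nontangential_orbit_zero_step]).

    A step tending to [0] forces [p (f^n w) z_n] to tend to [0] for every [w]
    ([zero_step_orbits_merge]). Otherwise this distance decreases to a positive
    limit, so for large [k] all further iterates of [f] almost preserve the distance
    from [z_k] to [f^k w]. An iterate of [f], normalised by automorphisms to fix the
    origin, is [s] times a function [q] with values in the closed disc; now [|q|] is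
    almost [1] at one point, and Schwarz-Pick for [q] keeps it away from [0] at the
    point that corresponds to [z_(k+1)]. The steps after time [k] would then stay
    above a fixed multiple of the step at time [k], which is nonzero because [f] has
    no fixed point ([three_point_schwarz_pick]).

    The complex analysis behind Schwarz-Pick rests on Goursat's theorem for
    rectangles. Applied in the coordinates [a + exp w] it gives the mean value
    property on circles around [a], for a function that is differentiable near [a]
    and only continuous at [a] itself. This suffices for a maximum principle that
    tolerates isolated points where differentiability is unknown, such as the
    origin for [q]. *)

(** * Moduli and neighbourhoods *)

Lemma Cmod_le_abs (z : C) : Cmod z <= Rabs (Re z) + Rabs (Im z).
Proof.
  destruct z as [x y]. cbn.
  replace (x, y) with (RtoC x + Ci * RtoC y)%C.
  - apply Rle_trans with (1 := Cmod_triangle _ _).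
    rewrite Cmod_mult, Cmod_Ci, !Cmod_R. lra.
  - apply injective_projections; cbn; ring.
Qed.

Lemma im_le_Cmod (z : C) : Rabs (Im z) <= Cmod z.
Proof. apply Rle_trans with (2 := Rmax_Cmod z). apply Rmax_r. Qed.

Lemma Cminus_neq_0 (z w : C) : z <> w -> (z - w)%C <> RtoC 0.
Proof. intros N E. apply N. replace z with (z - w + w)%C by ring. rewrite E. ring. Qed.

Lemma Cmod_sq (z : C) : Cmod z ^ 2 = fst z ^ 2 + snd z ^ 2.
Proof. exact (Cmod2_alt z). Qed.

Lemma Cmod_sub_ge (z w : C) : Cmod z - Cmod w <= Cmod (z - w)%C.
Proof.
  assert (T := Cmod_triangle (z - w)%C w).
  replace (z - w + w)%C with z in T by ring. lra.
Qed.

Lemma Cmod_sub_sym (z w : C) : Cmod (z - w)%C = Cmod (w - z)%C.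
Proof. rewrite <- Cmod_opp. f_equal. ring. Qed.

Lemma Cmod_sub_abs (z w : C) : Rabs (Cmod z - Cmod w) <= Cmod (z - w)%C.
Proof.
  apply Rabs_le. assert (A := Cmod_sub_ge z w). assert (B := Cmod_sub_ge w z).
  rewrite Cmod_sub_sym in B. lra.
Qed.

Lemma le_of_forall_eps (x y k : R) : 0 <= k ->
  (forall eps, 0 < eps -> x <= y + eps * k) -> x <= y.
Proof.
  intros Hk H. apply Rnot_lt_le. intros Hlt.
  specialize (H ((x - y) / (2 * (k + 1)))).
  assert (P : 0 < (x - y) / (2 * (k + 1))) by (apply Rdiv_lt_0_compat; lra).
  specialize (H P).
  assert (E : (x - y) / (2 * (k + 1)) * (2 * (k + 1)) = x - y) by (field; lra). nra.
Qed.

Lemma locally_Cmod (tau : C) (P : C -> Prop) : locally tau P ->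
  exists d, 0 < d /\ forall z, Cmod (z - tau)%C < d -> P z.
Proof.
  intros [d Hd]. exists d; split; [apply cond_pos|]. intros z Hz. apply Hd.
  exact (C_NormedModule_mixin_compat1 tau z d Hz).
Qed.

Lemma Cmod_locally (tau : C) (P : C -> Prop) (d : R) : 0 < d ->
  (forall z, Cmod (z - tau)%C < d -> P z) -> locally tau P.
Proof.
  intros Hd H. assert (Hd2 : 0 < d / 2) by lra. exists (mkposreal _ Hd2).
  intros z [Hz1 Hz2]. apply H. apply Rle_lt_trans with (1 := Cmod_le_abs _).
  unfold ball, AbsRing_ball, abs, minus, plus, opp in Hz1, Hz2; cbn in Hz1, Hz2. cbn.
  change (Rabs (fst z + - fst tau) < d / 2) in Hz1.
  change (Rabs (snd z + - snd tau) < d / 2) in Hz2. lra.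
Qed.

(** * Continuity and complex differentiability *)

(** Continuity in terms of the modulus, which avoids choosing between the product
    and the normed uniform structures on [C]. *)
Definition ccont (f : C -> C) (z : C) : Prop :=
  forall eps : R, 0 < eps -> exists delta : R, 0 < delta /\
    forall w : C, Cmod (w - z)%C < delta -> Cmod (f w - f z)%C < eps.

(** Carathéodory's form of complex differentiability: the derivative is [phi z].
    The rules for sums, products and composites then reduce to continuity. *)
Definition cdiff (f : C -> C) (z : C) : Prop :=
  exists phi : C -> C, ccont phi z /\
    forall w : C, (f w - f z = (w - z) * phi w)%C.

Lemma ccont_const (c z : C) : ccont (fun _ => c) z.
Proof.
  intros eps Heps; exists 1; split; [lra|]; intros w _.
  replace (c - c)%C with (RtoC 0) by ring. now rewrite Cmod_0.
Qed.

Lemma ccont_id (z : C) : ccont (fun w => w) z.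
Proof. intros eps Heps; exists eps; split; [lra|]; tauto. Qed.

Lemma ccont_comp (f g : C -> C) (z : C) :
  ccont g z -> ccont f (g z) -> ccont (fun w => f (g w)) z.
Proof.
  intros Hg Hf eps Heps.
  destruct (Hf eps Heps) as [d [Hd Hf']].
  destruct (Hg d Hd) as [d' [Hd' Hg']].
  exists d'; split; auto.
Qed.

Lemma ccont_plus (f g : C -> C) (z : C) :
  ccont f z -> ccont g z -> ccont (fun w => f w + g w)%C z.
Proof.
  intros Hf Hg eps Heps.
  destruct (Hf (eps / 2)) as [d [Hd Hf']]; [lra|].
  destruct (Hg (eps / 2)) as [d' [Hd' Hg']]; [lra|].
  exists (Rmin d d'); split; [now apply Rmin_pos|]. intros w Hw.
  assert (H1 := Hf' w (Rlt_le_trans _ _ _ Hw (Rmin_l _ _))).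
  assert (H2 := Hg' w (Rlt_le_trans _ _ _ Hw (Rmin_r _ _))).
  replace (f w + g w - (f z + g z))%C with ((f w - f z) + (g w - g z))%C by ring.
  apply Rle_lt_trans with (1 := Cmod_triangle _ _). lra.
Qed.

Lemma ccont_bounded (f : C -> C) (z : C) : ccont f z ->
  exists delta, 0 < delta /\
    forall w, Cmod (w - z)%C < delta -> Cmod (f w) < Cmod (f z) + 1.
Proof.
  intros Hf. destruct (Hf 1 Rlt_0_1) as [d [Hd Hf']].
  exists d; split; [exact Hd|]. intros w Hw.
  replace (f w) with ((f w - f z) + f z)%C by ring.
  apply Rle_lt_trans with (1 := Cmod_triangle _ _). specialize (Hf' w Hw). lra.
Qed.

Lemma ccont_mult (f g : C -> C) (z : C) :
  ccont f z -> ccont g z -> ccont (fun w => f w * g w)%C z.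
Proof.
  intros Hf Hg eps Heps.
  destruct (ccont_bounded g z Hg) as [d0 [Hd0 Hb]].
  assert (Pf := Cmod_ge_0 (f z)). assert (Pg := Cmod_ge_0 (g z)).
  destruct (Hf (eps / (2 * (Cmod (g z) + 1)))) as [d [Hd Hf']].
  { apply Rdiv_lt_0_compat; lra. }
  destruct (Hg (eps / (2 * (Cmod (f z) + 1)))) as [d' [Hd' Hg']].
  { apply Rdiv_lt_0_compat; lra. }
  exists (Rmin d0 (Rmin d d')); split; [repeat apply Rmin_pos; auto|]. intros w Hw.
  assert (H0 := Hb w (Rlt_le_trans _ _ _ Hw (Rmin_l _ _))).
  assert (Hw' := Rlt_le_trans _ _ _ Hw (Rmin_r _ _)).
  assert (H1 := Hf' w (Rlt_le_trans _ _ _ Hw' (Rmin_l _ _))).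
  assert (H2 := Hg' w (Rlt_le_trans _ _ _ Hw' (Rmin_r _ _))).
  replace (f w * g w - f z * g z)%C
    with ((f w - f z) * g w + f z * (g w - g z))%C by ring.
  apply Rle_lt_trans with (1 := Cmod_triangle _ _). rewrite !Cmod_mult.
  apply Rle_lt_trans with
    (Cmod (f w - f z)%C * (Cmod (g z) + 1) + Cmod (f z) * (eps / (2 * (Cmod (f z) + 1)))).
  { apply Rplus_le_compat; apply Rmult_le_compat_l; try apply Cmod_ge_0; lra. }
  apply (Rmult_lt_compat_r (Cmod (g z) + 1)) in H1; [|lra].
  replace (eps / (2 * (Cmod (g z) + 1)) * (Cmod (g z) + 1)) with (eps / 2) in H1
    by (field; lra).
  assert (Cmod (f z) * (eps / (2 * (Cmod (f z) + 1))) <= eps / 2); [|lra].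
  replace (Cmod (f z) * (eps / (2 * (Cmod (f z) + 1))))
    with (eps / 2 * (Cmod (f z) / (Cmod (f z) + 1))) by (field; lra).
  rewrite <- (Rmult_1_r (eps / 2)) at 2. apply Rmult_le_compat_l; [lra|].
  apply Rle_div_l; lra.
Qed.

Lemma ccont_inv (f : C -> C) (z : C) :
  ccont f z -> f z <> RtoC 0 -> ccont (fun w => / f w)%C z.
Proof.
  intros Hf Hz eps Heps.
  assert (P := proj1 (Cmod_gt_0 _) Hz).
  set (m := Cmod (f z)) in *.
  destruct (Hf (Rmin (m / 2) (eps * m * m / 2))) as [d [Hd Hf']].
  { apply Rmin_pos; [lra|]. apply Rdiv_lt_0_compat; [|lra].
    repeat apply Rmult_lt_0_compat; lra. }
  exists d; split; [exact Hd|]. intros w Hw. specialize (Hf' w Hw).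
  assert (H1 := Rlt_le_trans _ _ _ Hf' (Rmin_l _ _)).
  assert (H2 := Rlt_le_trans _ _ _ Hf' (Rmin_r _ _)).
  assert (Hm : m / 2 < Cmod (f w)).
  { assert (T := Cmod_triangle (f z - f w)%C (f w)).
    replace (f z - f w + f w)%C with (f z) in T by ring. fold m in T.
    replace (f z - f w)%C with (- (f w - f z))%C in T by ring. rewrite Cmod_opp in T. lra. }
  assert (Hw0 : f w <> RtoC 0) by (apply Cmod_gt_0; lra).
  replace (/ f w - / f z)%C with (- (f w - f z) * (/ f w * / f z))%C by (field; auto).
  rewrite !Cmod_mult, Cmod_opp, !Cmod_inv by auto. fold m.
  apply Rmult_lt_reg_r with (Cmod (f w) * m); [nra|].
  replace (Cmod (f w - f z)%C * (/ Cmod (f w) * / m) * (Cmod (f w) * m))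
    with (Cmod (f w - f z)%C) by (field; lra).
  apply Rlt_le_trans with (1 := H2).
  assert (0 < eps * m) by (apply Rmult_lt_0_compat; lra). nra.
Qed.

Lemma ccont_ext_loc (f g : C -> C) (z : C) (r : R) : 0 < r ->
  (forall w, Cmod (w - z)%C < r -> f w = g w) -> ccont f z -> ccont g z.
Proof.
  intros Hr E Hf eps Heps. destruct (Hf eps Heps) as [d [Hd H]].
  exists (Rmin r d); split; [now apply Rmin_pos|]. intros w Hw.
  assert (Hwr := Rlt_le_trans _ _ _ Hw (Rmin_l _ _)).
  assert (Hwd := Rlt_le_trans _ _ _ Hw (Rmin_r _ _)).
  rewrite <- !E; auto.
  replace (z - z)%C with (RtoC 0) by ring. now rewrite Cmod_0.
Qed.

Lemma cdiff_ccont (f : C -> C) (z : C) : cdiff f z -> ccont f z.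
Proof.
  intros [phi [Hphi E]].
  assert (H : ccont (fun w => (w + - z) * phi w + f z)%C z).
  { apply ccont_plus; [|apply ccont_const]. apply ccont_mult; [|exact Hphi].
    apply ccont_plus; [apply ccont_id|apply ccont_const]. }
  apply ccont_ext_loc with (3 := H) (r := 1); [lra|].
  intros w _. replace (w + - z)%C with (w - z)%C by ring. rewrite <- E. ring.
Qed.

Lemma cdiff_const (c z : C) : cdiff (fun _ => c) z.
Proof. exists (fun _ => RtoC 0); split; [apply ccont_const|]; intros; ring. Qed.

Lemma cdiff_id (z : C) : cdiff (fun w => w) z.
Proof. exists (fun _ => RtoC 1); split; [apply ccont_const|]; intros; ring. Qed.

Lemma cdiff_plus (f g : C -> C) (z : C) :
  cdiff f z -> cdiff g z -> cdiff (fun w => f w + g w)%C z.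
Proof.
  intros [p [Hp Ep]] [q [Hq Eq]].
  exists (fun w => p w + q w)%C; split; [now apply ccont_plus|]. intros w.
  replace (f w + g w - (f z + g z))%C with ((f w - f z) + (g w - g z))%C by ring.
  rewrite Ep, Eq. ring.
Qed.

Lemma cdiff_mult (f g : C -> C) (z : C) :
  cdiff f z -> cdiff g z -> cdiff (fun w => f w * g w)%C z.
Proof.
  intros Hf Hg. assert (Cg := cdiff_ccont _ _ Hg).
  destruct Hf as [p [Hp Ep]], Hg as [q [Hq Eq]].
  exists (fun w => p w * g w + f z * q w)%C; split.
  { apply ccont_plus; [now apply ccont_mult|]. apply ccont_mult; [apply ccont_const|exact Hq]. }
  intros w.
  replace (f w * g w - f z * g z)%C
    with ((f w - f z) * g w + f z * (g w - g z))%C by ring.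
  rewrite Ep, Eq. ring.
Qed.

Lemma cdiff_comp (f g : C -> C) (z : C) :
  cdiff g z -> cdiff f (g z) -> cdiff (fun w => f (g w)) z.
Proof.
  intros Hg [p [Hp Ep]]. assert (Cg := cdiff_ccont _ _ Hg).
  destruct Hg as [q [Hq Eq]].
  exists (fun w => q w * p (g w))%C; split.
  { apply ccont_mult; [exact Hq|]. now apply ccont_comp. }
  intros w. rewrite Ep, Eq. ring.
Qed.

Lemma cdiff_ext_loc (f g : C -> C) (z : C) (r : R) : 0 < r ->
  (forall w, Cmod (w - z)%C < r -> f w = g w) -> cdiff f z -> cdiff g z.
Proof.
  intros Hr E [p [Hp Ep]].
  exists (fun w => if Rlt_dec (Cmod (w - z)%C) r then p w else (g w - g z) / (w - z))%C.
  split.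
  - apply ccont_ext_loc with (3 := Hp) (r := r); [exact Hr|].
    intros w Hw. destruct (Rlt_dec _ _); [easy|contradiction].
  - assert (Ez : f z = g z).
    { apply E. replace (z - z)%C with (RtoC 0) by ring. now rewrite Cmod_0. }
    intros w. destruct (Rlt_dec _ _) as [Hw|Hw].
    + now rewrite <- Ep, E, Ez.
    + field. intros H. apply Hw. rewrite H, Cmod_0. exact Hr.
Qed.

Lemma cdiff_inv (f : C -> C) (z : C) :
  cdiff f z -> f z <> RtoC 0 -> cdiff (fun w => / f w)%C z.
Proof.
  intros Hf Hz. assert (Cf := cdiff_ccont _ _ Hf). destruct Hf as [p [Hp Ep]].
  assert (P := proj1 (Cmod_gt_0 _) Hz).
  destruct (Cf (Cmod (f z)) P) as [r [Hr Hf']].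
  assert (N : forall w, Cmod (w - z)%C < r -> f w <> RtoC 0).
  { intros w Hw H0. specialize (Hf' w Hw). rewrite H0 in Hf'.
    replace (0 - f z)%C with (- f z)%C in Hf' by ring. rewrite Cmod_opp in Hf'. lra. }
  exists (fun w => if Rlt_dec (Cmod (w - z)%C) r
      then - (p w * (/ f w * / f z)) else (/ f w - / f z) / (w - z))%C.
  split.
  - assert (H : ccont (fun w => -1 * (p w * (/ f w * / f z)))%C z).
    { apply ccont_mult; [apply ccont_const|]. apply ccont_mult; [exact Hp|].
      apply ccont_mult; [|apply ccont_const]. now apply ccont_inv. }
    apply ccont_ext_loc with (3 := H) (r := r); [exact Hr|].
    intros w Hw. destruct (Rlt_dec _ _); [ring|contradiction].
  - intros w. destruct (Rlt_dec _ _) as [Hw|Hw].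
    + replace (/ f w - / f z)%C with (- ((f w - f z) * (/ f w * / f z)))%C
        by (field; split; auto).
      rewrite Ep. ring.
    + set (X := (/ f w - / f z)%C). field.
      intros H. apply Hw. rewrite H, Cmod_0. exact Hr.
Qed.

Lemma is_derive_little_o (f : C -> C) (z l : C) :
  is_derive (K := C_AbsRing) (V := C_NormedModule) f z l ->
  forall eps, 0 < eps -> exists delta, 0 < delta /\
    forall w, Cmod (w - z)%C < delta ->
      Cmod (f w - f z - (w - z) * l)%C <= eps * Cmod (w - z)%C.
Proof.
  intros [_ Hf] eps Heps.
  destruct (Hf z (fun P H => H) (mkposreal eps Heps)) as [d Hd].
  exists d; split; [apply cond_pos|]. intros w Hw. exact (Hd w Hw).
Qed.

Lemma ex_derive_cdiff (f : C -> C) (z : C) :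
  ex_derive (K := C_AbsRing) (V := C_NormedModule) f z -> cdiff f z.
Proof.
  intros [l Hl].
  exists (fun w => if excluded_middle_informative (w = z) then l
                   else (f w - f z) / (w - z))%C.
  split.
  - intros eps Heps. destruct (is_derive_little_o f z l Hl (eps / 2)) as [d [Hd H]]; [lra|].
    exists d; split; [exact Hd|]. intros w Hw.
    destruct (excluded_middle_informative (z = z)) as [_|N]; [|now contradiction N].
    destruct (excluded_middle_informative (w = z)) as [->|N].
    + replace (l - l)%C with (RtoC 0) by ring. now rewrite Cmod_0.
    + assert (Hz : (w - z)%C <> RtoC 0).
      { intros E. apply N. replace w with (w - z + z)%C by ring. rewrite E. ring. }
      replace ((f w - f z) / (w - z) - l)%C with ((f w - f z - (w - z) * l) / (w - z))%C
        by (field; exact Hz).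
      rewrite Cmod_div by exact Hz. specialize (H w Hw).
      apply Cmod_gt_0 in Hz. apply Rle_lt_trans with (eps / 2); [|lra].
      now apply Rle_div_l.
  - intros w. destruct (excluded_middle_informative (w = z)) as [->|N]; [ring|].
    field. intros E. apply N. replace w with (w - z + z)%C by ring. rewrite E. ring.
Qed.

Lemma cdiff_little_o (g : C -> C) (z : C) (eps : R) : cdiff g z -> 0 < eps ->
  exists l delta, 0 < delta /\ forall w, Cmod (w - z)%C < delta ->
    Cmod (g w - g z - (w - z) * l)%C <= eps * Cmod (w - z)%C.
Proof.
  intros [phi [Hphi E]] Heps. destruct (Hphi eps Heps) as [d [Hd H]].
  exists (phi z), d; split; [exact Hd|]. intros w Hw. rewrite E.
  replace ((w - z) * phi w - (w - z) * phi z)%C with ((phi w - phi z) * (w - z))%C by ring.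
  rewrite Cmod_mult. apply Rmult_le_compat_r; [apply Cmod_ge_0|].
  apply Rlt_le. auto.
Qed.

(** * Goursat's theorem on rectangles *)

(** The imaginary part of the integral of [g] along the boundary of the rectangle
    with horizontal side [[a, b]] and vertical side [[c, d]]. Working with one real
    part at a time keeps all integrals real. *)
Definition rect_integral (g : C -> C) (a b c d : R) : R :=
  RInt (fun x => Im (g (x, c)) - Im (g (x, d))) a b +
  RInt (fun y => Re (g (b, y)) - Re (g (a, y))) c d.

Definition cdiff_rect (g : C -> C) (a b c d : R) : Prop :=
  forall x y, a <= x <= b -> c <= y <= d -> cdiff g (x, y).

Lemma ccont_Re_line (g : C -> C) (p : R -> C) (t : R) :
  (forall s s', Cmod (p s - p s')%C <= Rabs (s - s')) -> ccont g (p t) ->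
  continuous (fun s => Re (g (p s))) t /\ continuous (fun s => Im (g (p s))) t.
Proof.
  intros Hp Hg.
  assert (A : forall eps : posreal, locally t (fun s => Cmod (g (p s) - g (p t))%C < eps)).
  { intros eps. destruct (Hg eps (cond_pos eps)) as [d [Hd H]].
    exists (mkposreal d Hd). intros s Hs. apply H.
    apply Rle_lt_trans with (1 := Hp _ _). exact Hs. }
  split; intros P [eps HP]; destruct (A eps) as [d Hd]; exists d; intros s Hs; apply HP;
    specialize (Hd s Hs).
  - apply Rle_lt_trans with (2 := Hd). exact (re_le_Cmod (g (p s) - g (p t))%C).
  - apply Rle_lt_trans with (2 := Hd). exact (im_le_Cmod (g (p s) - g (p t))%C).
Qed.

Lemma horizontal_line (y s s' : R) : Cmod ((s, y) - (s', y))%C <= Rabs (s - s').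
Proof.
  apply Rle_trans with (1 := Cmod_le_abs _). cbn.
  replace (y + - y) with 0 by ring. rewrite Rabs_R0. unfold Rminus. lra.
Qed.

Lemma vertical_line (x s s' : R) : Cmod ((x, s) - (x, s'))%C <= Rabs (s - s').
Proof.
  apply Rle_trans with (1 := Cmod_le_abs _). cbn.
  replace (x + - x) with 0 by ring. rewrite Rabs_R0. unfold Rminus. lra.
Qed.

Lemma RInt_near_const (f : R -> R) (u v k e : R) : u <= v -> ex_RInt f u v ->
  (forall t, u <= t <= v -> Rabs (f t - k) <= e) ->
  Rabs (RInt f u v - k * (v - u)) <= e * (v - u).
Proof.
  intros Huv Hf H.
  assert (E : RInt (fun t => f t - k) u v = RInt f u v - k * (v - u)).
  { rewrite (RInt_minus (V := R_CompleteNormedModule) f (fun _ => k));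
      [|exact Hf|apply ex_RInt_const].
    rewrite RInt_const. unfold minus, opp, plus, scal, mult; cbn; unfold mult; cbn. ring. }
  rewrite <- E, Rmult_comm. apply abs_RInt_le_const; auto.
  apply (ex_RInt_minus (V := R_CompleteNormedModule)); [exact Hf|apply ex_RInt_const].
Qed.

Section Rectangle.
Variables (g : C -> C) (a b c d : R).
Hypothesis g_diff : cdiff_rect g a b c d.

Lemma ex_RInt_horizontal (a' b' y : R) :
  a <= a' -> a' <= b' -> b' <= b -> c <= y <= d ->
  ex_RInt (fun x => Im (g (x, y))) a' b'.
Proof.
  intros Ha Hab Hb Hy. apply (ex_RInt_continuous (V := R_CompleteNormedModule)).
  intros x. rewrite Rmin_left, Rmax_right by exact Hab. intros Hx.
  apply (ccont_Re_line g (fun x => (x, y))); [apply horizontal_line|].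
  apply cdiff_ccont, g_diff; lra.
Qed.

Lemma ex_RInt_vertical (c' d' x : R) :
  c <= c' -> c' <= d' -> d' <= d -> a <= x <= b ->
  ex_RInt (fun y => Re (g (x, y))) c' d'.
Proof.
  intros Ha Hab Hb Hy. apply (ex_RInt_continuous (V := R_CompleteNormedModule)).
  intros y. rewrite Rmin_left, Rmax_right by exact Hab. intros Hx.
  apply (ccont_Re_line g (fun y => (x, y))); [apply vertical_line|].
  apply cdiff_ccont, g_diff; lra.
Qed.

Lemma rect_integral_split_x (m : R) : a <= m <= b -> c <= d ->
  rect_integral g a b c d = rect_integral g a m c d + rect_integral g m b c d.
Proof.
  intros Hm Hcd. unfold rect_integral.
  rewrite <- (RInt_Chasles (V := R_CompleteNormedModule)
    (fun x => Im (g (x, c)) - Im (g (x, d))) a m b);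
    try (apply (ex_RInt_minus (V := R_CompleteNormedModule)); apply ex_RInt_horizontal; lra).
  rewrite !(RInt_minus (V := R_CompleteNormedModule)
    (fun y => Re (g (_, y))) (fun y => Re (g (_, y))))
    by (apply ex_RInt_vertical; lra).
  unfold plus, minus, opp; cbn; unfold plus, opp; cbn. ring.
Qed.

Lemma rect_integral_split_y (m : R) : c <= m <= d -> a <= b ->
  rect_integral g a b c d = rect_integral g a b c m + rect_integral g a b m d.
Proof.
  intros Hm Hab. unfold rect_integral.
  rewrite <- (RInt_Chasles (V := R_CompleteNormedModule)
    (fun y => Re (g (b, y)) - Re (g (a, y))) c m d);
    try (apply (ex_RInt_minus (V := R_CompleteNormedModule)); apply ex_RInt_vertical; lra).
  rewrite !(RInt_minus (V := R_CompleteNormedModule)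
    (fun y => Im (g (y, _))) (fun y => Im (g (y, _))))
    by (apply ex_RInt_horizontal; lra).
  unfold plus, minus, opp; cbn; unfold plus, opp; cbn. ring.
Qed.

(** The affine approximation of [g] at [z] contributes opposite amounts to the
    horizontal and to the vertical sides, so only the remainder, of size [eps] times
    the diameter, is integrated over the perimeter. *)
Lemma rect_integral_small (z l : C) (eps : R) : a <= b -> c <= d -> 0 <= eps ->
  (a <= Re z <= b) -> (c <= Im z <= d) ->
  (forall x y, a <= x <= b -> c <= y <= d ->
     Cmod (g (x, y) - g z - ((x, y) - z) * l)%C <= eps * Cmod ((x, y) - z)%C) ->
  Rabs (rect_integral g a b c d) <= 2 * eps * ((b - a) + (d - c)) ^ 2.
Proof.
  intros Hab Hcd Heps Hz1 Hz2 H.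
  set (s := (b - a) + (d - c)).
  assert (H' : forall x y, a <= x <= b -> c <= y <= d ->
     Cmod (g (x, y) - g z - ((x, y) - z) * l)%C <= eps * s).
  { intros x y Hx Hy. apply Rle_trans with (1 := H x y Hx Hy).
    apply Rmult_le_compat_l; [exact Heps|]. apply Rle_trans with (1 := Cmod_le_abs _).
    destruct z as [z1 z2]; cbn in *. unfold s. apply Rplus_le_compat; apply Rabs_le; lra. }
  assert (K : forall x y x' y', a <= x <= b -> c <= y <= d -> a <= x' <= b -> c <= y' <= d ->
     Cmod (g (x, y) - g (x', y') - ((x, y) - (x', y')) * l)%C <= 2 * eps * s).
  { intros x y x' y' Hx Hy Hx' Hy'. assert (A := H' x y Hx Hy). assert (B := H' x' y' Hx' Hy').
    replace (g (x, y) - g (x', y') - ((x, y) - (x', y')) * l)%C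
      with ((g (x, y) - g z - ((x, y) - z) * l) + - (g (x', y') - g z - ((x', y') - z) * l))%C
      by ring.
    apply Rle_trans with (1 := Cmod_triangle _ _). rewrite Cmod_opp. lra. }
  assert (A : Rabs (RInt (fun x => Im (g (x, c)) - Im (g (x, d))) a b
                    - (- (d - c) * Re l) * (b - a)) <= 2 * eps * s * (b - a)).
  { apply RInt_near_const; [exact Hab| |].
    - apply (ex_RInt_minus (V := R_CompleteNormedModule)); apply ex_RInt_horizontal; lra.
    - intros x Hx.
      assert (T := Rle_trans _ _ _ (im_le_Cmod _) (K x c x d Hx ltac:(lra) Hx ltac:(lra))).
      refine (Rle_trans _ _ _ (Req_le _ _ _) T). f_equal.
      destruct l; cbn. unfold Im, Re; cbn. ring. }
  assert (B : Rabs (RInt (fun y => Re (g (b, y)) - Re (g (a, y))) c d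
                    - ((b - a) * Re l) * (d - c)) <= 2 * eps * s * (d - c)).
  { apply RInt_near_const; [exact Hcd| |].
    - apply (ex_RInt_minus (V := R_CompleteNormedModule)); apply ex_RInt_vertical; lra.
    - intros y Hy.
      assert (T := Rle_trans _ _ _ (re_le_Cmod _) (K b y a y ltac:(lra) Hy ltac:(lra) Hy)).
      refine (Rle_trans _ _ _ (Req_le _ _ _) T). f_equal.
      destruct l; cbn. unfold Im, Re; cbn. ring. }
  unfold rect_integral.
  match goal with |- Rabs (?X + ?Y) <= _ =>
    replace (X + Y) with ((X - (- (d - c) * Re l) * (b - a)) + (Y - ((b - a) * Re l) * (d - c)))
      by ring end.
  apply Rle_trans with (1 := Rabs_triang _ _).
  replace (2 * eps * s ^ 2) with (2 * eps * s * (b - a) + 2 * eps * s * (d - c))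
    by (unfold s; ring).
  lra.
Qed.
End Rectangle.

Lemma cdiff_rect_sub (g : C -> C) (a b c d a' b' c' d' : R) :
  cdiff_rect g a b c d -> a <= a' -> b' <= b -> c <= c' -> d' <= d ->
  cdiff_rect g a' b' c' d'.
Proof. intros H ? ? ? ? x y Hx Hy. apply H; lra. Qed.

Lemma rect_integral_quarters (g : C -> C) (a c h k B : R) : 0 <= h -> 0 <= k ->
  cdiff_rect g a (a + 2 * h) c (c + 2 * k) ->
  (forall a' c', a <= a' <= a + h -> c <= c' <= c + k ->
     Rabs (rect_integral g a' (a' + h) c' (c' + k)) <= B) ->
  Rabs (rect_integral g a (a + 2 * h) c (c + 2 * k)) <= 4 * B.
Proof.
  intros Hh Hk Hg HB.
  rewrite (rect_integral_split_x g a _ c _ Hg (a + h)) by lra.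
  rewrite (rect_integral_split_y g a _ c (c + 2 * k)) with (m := c + k);
    [|eapply cdiff_rect_sub; [exact Hg|lra..]|lra|lra].
  rewrite (rect_integral_split_y g (a + h) _ c (c + 2 * k)) with (m := c + k);
    [|eapply cdiff_rect_sub; [exact Hg|lra..]|lra|lra].
  assert (A1 := HB a c ltac:(lra) ltac:(lra)).
  assert (A2 := HB a (c + k) ltac:(lra) ltac:(lra)).
  assert (A3 := HB (a + h) c ltac:(lra) ltac:(lra)).
  assert (A4 := HB (a + h) (c + k) ltac:(lra) ltac:(lra)).
  replace (a + 2 * h) with (a + h + h) by ring.
  replace (c + 2 * k) with (c + k + k) by ring.
  eapply Rle_trans; [apply Rabs_triang|].
  eapply Rle_trans; [apply Rplus_le_compat; apply Rabs_triang|]. lra.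
Qed.

Lemma nested_intervals_point (u h : nat -> R) :
  (forall n, u n <= u (S n)) -> (forall n, u (S n) + h (S n) <= u n + h n) ->
  (forall n, 0 <= h n) -> exists x, forall n, u n <= x <= u n + h n.
Proof.
  intros Hu Hv Hh.
  assert (Iu : forall n m, u n <= u (n + m)%nat).
  { intros n. induction m as [|m IH]; [rewrite Nat.add_0_r; lra|].
    rewrite Nat.add_succ_r. specialize (Hu (n + m)%nat). lra. }
  assert (Iv : forall n m, u (n + m)%nat + h (n + m)%nat <= u n + h n).
  { intros n. induction m as [|m IH]; [rewrite Nat.add_0_r; lra|].
    rewrite Nat.add_succ_r. specialize (Hv (n + m)%nat). lra. }
  assert (B : forall n m, u m <= u n + h n).
  { intros n m. apply Rle_trans with (u (m + n)%nat); [apply Iu|].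
    rewrite Nat.add_comm. specialize (Iv n m). specialize (Hh (n + m)%nat). lra. }
  destruct (completeness (fun t => exists m, t = u m)) as [x [Hx1 Hx2]].
  - exists (u 0%nat + h 0%nat). intros t [m ->]. apply B.
  - exists (u 0%nat). now exists 0%nat.
  - exists x. intros n. split.
    + apply Hx1. now exists n.
    + apply Hx2. intros t [m ->]. apply B.
Qed.

(** Quartering: if the integral were nonzero, some quarter would carry at least a
    quarter of it, and so on; the nested rectangles shrink to a point, where
    differentiability makes the integral too small for their size. *)
Lemma goursat (g : C -> C) (a b c d : R) : a <= b -> c <= d ->
  cdiff_rect g a b c d -> rect_integral g a b c d = 0.
Proof.
  intros Hab Hcd Hg.
  destruct (Req_dec (rect_integral g a b c d) 0) as [E|N]; [exact E|exfalso].
  apply Rabs_pos_lt in N.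
  set (s := (b - a) + (d - c)).
  assert (Hs : 0 <= s) by (unfold s; lra).
  set (J := Rabs (rect_integral g a b c d)) in *.
  (* Then [2 * eps * s ^ 2 < J]: the whole rectangle is bad in the sense below. *)
  set (eps := J / (4 * (s ^ 2 + 1))).
  assert (Heps : 0 < eps) by (apply Rdiv_lt_0_compat; [lra|nra]).
  set (h := fun n : nat => (b - a) / 2 ^ n). set (k := fun n : nat => (d - c) / 2 ^ n).
  assert (P2 : forall n, 0 < 2 ^ n) by (intros; apply pow_lt; lra).
  assert (Hh : forall n, 0 <= h n) by (intros; apply Rdiv_le_0_compat; [lra|auto]).
  assert (Hk : forall n, 0 <= k n) by (intros; apply Rdiv_le_0_compat; [lra|auto]).
  assert (Eh : forall n, h n = 2 * h (S n)).
  { intros n. unfold h. cbn [pow]. field. apply Rgt_not_eq, P2. }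
  assert (Ek : forall n, k n = 2 * k (S n)).
  { intros n. unfold k. cbn [pow]. field. apply Rgt_not_eq, P2. }
  (* [p] is the lower left corner of a rectangle of generation [n] on which the
     integral exceeds the bound that [rect_integral_small] would give. *)
  set (bad := fun (n : nat) (p : R * R) =>
    (a <= fst p /\ fst p + h n <= b /\ c <= snd p /\ snd p + k n <= d) /\
    2 * eps * (h n + k n) ^ 2 <
      Rabs (rect_integral g (fst p) (fst p + h n) (snd p) (snd p + k n))).
  assert (Step : forall n p, exists p', bad n p -> bad (S n) p' /\
    fst p <= fst p' /\ fst p' + h (S n) <= fst p + h n /\
    snd p <= snd p' /\ snd p' + k (S n) <= snd p + k n).
  { intros n p. apply NNPP. intros No.
    assert (Hp : bad n p). { apply NNPP. intros H. apply No. exists p. tauto. }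
    destruct Hp as [Hin Hbig]. rewrite Eh, Ek in Hin, Hbig.
    apply (Rlt_not_le _ _ Hbig).
    replace (2 * eps * (2 * h (S n) + 2 * k (S n)) ^ 2)
      with (4 * (2 * eps * (h (S n) + k (S n)) ^ 2)) by ring.
    apply rect_integral_quarters; auto.
    - eapply cdiff_rect_sub; [exact Hg|lra..].
    - intros a' c' Ha' Hc'. apply Rnot_lt_le. intros H. apply No. exists (a', c').
      intros _. unfold bad. cbn [fst snd]. rewrite !(Eh n), !(Ek n).
      repeat split; try lra. }
  set (next := fun n p => proj1_sig (constructive_indefinite_description _ (Step n p))).
  set (p := fix p n := match n with O => (a, c) | S m => next m (p m) end).
  assert (Hp : forall n, bad n (p n)).
  { induction n as [|n IH].
    - unfold bad. cbn [p fst snd].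
      assert (E0 : h 0%nat = b - a) by (unfold h; cbn; field).
      assert (E1 : k 0%nat = d - c) by (unfold k; cbn; field).
      rewrite E0, E1. split; [lra|].
      replace (a + (b - a)) with b by ring. replace (c + (d - c)) with d by ring.
      fold s J. unfold eps. apply Rmult_lt_reg_r with (2 * (s ^ 2 + 1)); [nra|].
      replace (2 * (J / (4 * (s ^ 2 + 1))) * s ^ 2 * (2 * (s ^ 2 + 1)))
        with (J * s ^ 2) by (field; nra). nra.
    - cbn [p]. unfold next at 1.
      destruct (constructive_indefinite_description _ _) as [p' H]. cbn. now apply H. }
  assert (Hn : forall n, fst (p n) <= fst (p (S n)) /\
      fst (p (S n)) + h (S n) <= fst (p n) + h n /\
      snd (p n) <= snd (p (S n)) /\ snd (p (S n)) + k (S n) <= snd (p n) + k n).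
  { intros n. cbn [p]. unfold next at 1 2 3 4.
    destruct (constructive_indefinite_description _ _) as [p' H]. cbn. now apply H. }
  destruct (nested_intervals_point (fun n => fst (p n)) h) as [x Hx];
    try (intros; apply Hn); auto.
  destruct (nested_intervals_point (fun n => snd (p n)) k) as [y Hy];
    try (intros; apply Hn); auto.
  assert (Hxy : cdiff g (x, y)).
  { destruct (Hp 0%nat) as [Hin _]. specialize (Hx 0%nat). specialize (Hy 0%nat).
    cbn beta in *. apply Hg; lra. }
  destruct (cdiff_little_o g (x, y) eps Hxy Heps) as [l [e [He H]]].
  assert (Small : exists n, h n + k n < e).
  { destruct (pow_lt_1_zero (/ 2) ltac:(rewrite Rabs_pos_eq; lra) (e / (s + 1))) as [n Hn'].
    { apply Rdiv_lt_0_compat; lra. }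
    exists n. specialize (Hn' n (Nat.le_refl n)).
    rewrite pow_inv, Rabs_pos_eq in Hn' by (apply Rlt_le, Rinv_0_lt_compat, P2).
    apply Rmult_lt_compat_r with (r := s + 1) in Hn'; [|lra].
    replace (e / (s + 1) * (s + 1)) with e in Hn' by (field; lra).
    replace (h n + k n) with (/ 2 ^ n * s) by (unfold h, k, s; field; apply Rgt_not_eq, P2).
    apply Rle_lt_trans with (2 := Hn'). apply Rmult_le_compat_l; [|lra].
    apply Rlt_le, Rinv_0_lt_compat, P2. }
  destruct Small as [n Hsmall]. destruct (Hp n) as [Hin Hbig].
  specialize (Hx n). specialize (Hy n). specialize (Hh n). specialize (Hk n).
  cbn beta in Hx, Hy.
  apply (Rlt_not_le _ _ Hbig).
  replace (h n + k n) with ((fst (p n) + h n - fst (p n)) + (snd (p n) + k n - snd (p n)))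
    by ring.
  apply rect_integral_small with (z := (x, y)) (l := l); cbn; try lra.
  - eapply cdiff_rect_sub; [exact Hg|lra..].
  - intros x' y' Hx' Hy'. apply H.
    apply Rle_lt_trans with (1 := Cmod_le_abs _). cbn.
    apply Rle_lt_trans with (2 := Hsmall). apply Rplus_le_compat; apply Rabs_le; lra.
Qed.

(** * The mean value property *)

Definition cexp (z : C) : C := (exp (Re z) * cos (Im z), exp (Re z) * sin (Im z)).

Lemma cexp_plus (z w : C) : cexp (z + w)%C = (cexp z * cexp w)%C.
Proof.
  destruct z as [x y], w as [x' y']. unfold cexp, Cmult, Re, Im; cbn.
  rewrite exp_plus, cos_plus, sin_plus. apply injective_projections; cbn; ring.
Qed.

Lemma Cmod_cexp (z : C) : Cmod (cexp z) = exp (Re z).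
Proof.
  unfold Cmod, cexp; cbn.
  replace (exp (Re z) * cos (Im z) * (exp (Re z) * cos (Im z) * 1) +
    exp (Re z) * sin (Im z) * (exp (Re z) * sin (Im z) * 1))
    with ((exp (Re z))² * ((sin (Im z))² + (cos (Im z))²)) by (unfold Rsqr; ring).
  rewrite sin2_cos2, Rmult_1_r. apply sqrt_Rsqr, Rlt_le, exp_pos.
Qed.

Lemma derivable_little_o (f : R -> R) (l eps : R) : derivable_pt_lim f 0 l -> 0 < eps ->
  exists d, 0 < d /\ forall h, Rabs h < d -> Rabs (f h - f 0 - l * h) <= eps * Rabs h.
Proof.
  intros H Heps. destruct (H eps Heps) as [d Hd]. exists d; split; [apply cond_pos|].
  intros h Hh. destruct (Req_dec h 0) as [->|N].
  - replace (f 0 - f 0 - l * 0) with 0 by ring. rewrite Rabs_R0. lra.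
  - specialize (Hd h N Hh). rewrite Rplus_0_l in Hd.
    replace (f h - f 0 - l * h) with (((f h - f 0) / h - l) * h) by (field; exact N).
    rewrite Rabs_mult. apply Rmult_le_compat_r; [apply Rabs_pos|lra].
Qed.

(** The derivative of the exponential at the origin is [1]; the addition formula
    carries this to every point. *)
Lemma cexp_little_o (eps : R) : 0 < eps -> exists d, 0 < d /\
  forall h, Cmod h < d -> Cmod (cexp h - 1 - h)%C <= eps * Cmod h.
Proof.
  intros Heps. set (e := Rmin (eps / 10) (1 / 10)).
  assert (He : 0 < e) by (apply Rmin_pos; lra).
  assert (He1 : e <= eps / 10) by apply Rmin_l.
  assert (He2 : e <= 1 / 10) by apply Rmin_r.
  destruct (derivable_little_o exp 1 e) as [d1 [Hd1 H1]]; [|lra|].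
  { rewrite <- exp_0. apply derivable_pt_lim_exp. }
  destruct (derivable_little_o cos 0 e) as [d2 [Hd2 H2]]; [|lra|].
  { replace 0 with (- sin 0) at 2 by (rewrite sin_0; ring). apply derivable_pt_lim_cos. }
  destruct (derivable_little_o sin 1 e) as [d3 [Hd3 H3]]; [|lra|].
  { rewrite <- cos_0. apply derivable_pt_lim_sin. }
  exists (Rmin (Rmin d1 d2) (Rmin d3 e)); split; [repeat apply Rmin_pos; lra|].
  intros [x y] Hh.
  assert (Hx : Rabs x <= Cmod (x, y)) by apply (re_le_Cmod (x, y)).
  assert (Hy : Rabs y <= Cmod (x, y)) by apply (im_le_Cmod (x, y)).
  set (m := Cmod (x, y)) in *.
  apply Rmin_Rgt in Hh as [Hh1 Hh2].
  apply Rmin_Rgt in Hh1 as [Hm1 Hm2]. apply Rmin_Rgt in Hh2 as [Hm3 Hm4].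
  specialize (H1 x ltac:(lra)). specialize (H2 y ltac:(lra)). specialize (H3 y ltac:(lra)).
  rewrite exp_0 in H1. rewrite cos_0 in H2. rewrite sin_0 in H3.
  assert (Hc : Rabs (cos y) <= 1) by (apply Rabs_le, COS_bound).
  assert (Px := Rabs_pos x). assert (Py := Rabs_pos y).
  set (E := exp x - 1 - 1 * x) in *. set (K := cos y - 1 - 0 * y) in *.
  set (S := sin y - 0 - 1 * y) in *.
  apply Rle_trans with (1 := Cmod_le_abs _).
  unfold cexp, Re, Im; cbn.
  replace (exp x * cos y + - (1) + - x) with (E * cos y + (1 + x) * K) by (unfold E, K; ring).
  replace (exp x * sin y + - 0 + - y) with ((1 + x + E) * S + (x + E) * y)
    by (unfold E, S; ring).
  assert (T1 := Rabs_triang (E * cos y) ((1 + x) * K)).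
  assert (T2 := Rabs_triang ((1 + x + E) * S) ((x + E) * y)).
  assert (T3 := Rabs_triang (1 + x) E). assert (T4 := Rabs_triang 1 x).
  assert (T5 := Rabs_triang x E). rewrite Rabs_R1 in T4.
  rewrite !Rabs_mult in T1, T2.
  assert (E1 : Rabs E <= e * m) by nra.
  assert (K1 : Rabs K <= e * m) by nra.
  assert (S1 : Rabs S <= e * m) by nra.
  assert (Hem : e * m <= m) by nra.
  assert (A1 : Rabs E * Rabs (cos y) <= e * m * 1)
    by (apply Rmult_le_compat; auto using Rabs_pos).
  assert (A2 : Rabs (1 + x) * Rabs K <= 2 * (e * m))
    by (apply Rmult_le_compat; auto using Rabs_pos; lra).
  assert (A3 : Rabs (1 + x + E) * Rabs S <= 3 * (e * m))
    by (apply Rmult_le_compat; auto using Rabs_pos; lra).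
  assert (A4 : Rabs (x + E) * Rabs y <= 2 * e * m)
    by (apply Rmult_le_compat; auto using Rabs_pos; lra).
  assert (e * m <= eps / 10 * m) by (apply Rmult_le_compat_r; lra).
  assert (0 <= eps * m) by (apply Rmult_le_pos; lra). lra.
Qed.

Lemma cexp_0 : cexp 0 = RtoC 1.
Proof.
  unfold cexp; cbn. rewrite exp_0, cos_0, sin_0. apply injective_projections; cbn; ring.
Qed.

Lemma cdiff_cexp (z : C) : cdiff cexp z.
Proof.
  assert (H0 : cdiff cexp 0).
  { exists (fun w : C => if excluded_middle_informative (w = RtoC 0) then RtoC 1
                     else (cexp w - 1) / w)%C.
    split.
    - intros eps Heps. destruct (cexp_little_o (eps / 2)) as [d [Hd H]]; [lra|].
      exists d; split; [exact Hd|]. intros w Hw.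
      destruct (excluded_middle_informative (RtoC 0 = RtoC 0)) as [_|N]; [|now contradiction N].
      destruct (excluded_middle_informative (w = RtoC 0)) as [->|N].
      + replace (1 - 1)%C with (RtoC 0) by ring. now rewrite Cmod_0.
      + replace (w - 0)%C with w in Hw by ring.
        replace ((cexp w - 1) / w - 1)%C with ((cexp w - 1 - w) / w)%C by (field; exact N).
        rewrite Cmod_div by exact N. specialize (H w Hw).
        apply Cmod_gt_0 in N. apply Rle_lt_trans with (eps / 2); [|lra].
        now apply Rle_div_l.
    - intros w. rewrite cexp_0. destruct (excluded_middle_informative (w = RtoC 0)) as [->|N].
      + rewrite cexp_0. ring.
      + field. exact N. }
  apply cdiff_ext_loc with (f := fun w => (cexp z * cexp (w + - z))%C) (r := 1); [lra| |].
  { intros w _. rewrite <- cexp_plus. f_equal. ring. }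
  apply cdiff_mult; [apply cdiff_const|].
  apply (cdiff_comp cexp (fun w => w + - z)%C).
  - apply cdiff_plus; [apply cdiff_id|apply cdiff_const].
  - replace (z + - z)%C with (RtoC 0) by ring. exact H0.
Qed.

Lemma cexp_2PI (x : R) : cexp (x, 2 * PI) = cexp (x, 0).
Proof. unfold cexp; cbn. now rewrite cos_2PI, sin_2PI, cos_0, sin_0. Qed.

Section MeanValue.
Variables (g : C -> C) (a : C) (r : R).
Hypothesis g_diff : forall w, 0 < Cmod (w - a)%C < r -> cdiff g w.
Hypothesis g_cont : ccont g a.

Let G (w : C) : C := g (a + cexp w)%C.

Lemma cdiff_polar (w : C) : exp (Re w) < r -> cdiff G w.
Proof.
  intros Hw. apply (cdiff_comp g (fun w => a + cexp w)%C).
  - apply cdiff_plus; [apply cdiff_const|apply cdiff_cexp].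
  - apply g_diff. replace (a + cexp w - a)%C with (cexp w) by ring.
    rewrite Cmod_cexp. split; [apply exp_pos|exact Hw].
Qed.

Lemma ex_RInt_polar (s : R) : exp s < r ->
  ex_RInt (fun y => Re (g (a + cexp (s, y))%C)) 0 (2 * PI).
Proof.
  intros Hs. assert (P := PI_RGT_0).
  apply (ex_RInt_vertical G s s 0 (2 * PI)); try lra.
  intros x y Hx Hy. apply cdiff_polar. cbn. replace x with s by lra. exact Hs.
Qed.

(** The two horizontal sides cancel because the exponential has period [2 i PI]. *)
Lemma polar_RInt_const (s t : R) : s <= t -> exp t < r ->
  RInt (fun y => Re (g (a + cexp (s, y))%C)) 0 (2 * PI) =
  RInt (fun y => Re (g (a + cexp (t, y))%C)) 0 (2 * PI).
Proof.
  intros Hst Ht. assert (P := PI_RGT_0).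
  assert (D : cdiff_rect G s t 0 (2 * PI)).
  { intros x y Hx Hy. apply cdiff_polar. cbn. apply Rle_lt_trans with (2 := Ht).
    destruct (Req_dec x t) as [->|]; [lra|]. apply Rlt_le, exp_increasing. lra. }
  assert (J := goursat G s t 0 (2 * PI) Hst ltac:(lra) D).
  unfold rect_integral in J.
  rewrite (RInt_ext _ (fun _ => 0)) in J.
  2:{ intros x _. apply Rminus_diag_eq. unfold G. now rewrite cexp_2PI. }
  rewrite RInt_const in J.
  rewrite (RInt_minus (V := R_CompleteNormedModule)
    (fun y => Re (G (_, y))) (fun y => Re (G (_, y)))) in J;
    [|apply (ex_RInt_vertical G s t 0 (2 * PI)); auto; lra
     |apply (ex_RInt_vertical G s t 0 (2 * PI)); auto; lra].
  change ((t - s) * 0 + (RInt (fun y => Re (g (a + cexp (t, y))%C)) 0 (2 * PI) +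
    - RInt (fun y => Re (g (a + cexp (s, y))%C)) 0 (2 * PI)) = 0) in J.
  lra.
Qed.

(** The integral over the circle does not depend on the radius, and shrinking the
    radius brings it to the value at the centre. *)
Lemma mean_value (t : R) : exp t < r ->
  RInt (fun y => Re (g (a + cexp (t, y))%C)) 0 (2 * PI) = Re (g a) * (2 * PI).
Proof.
  intros Ht. assert (P := PI_RGT_0).
  apply Rminus_diag_uniq. apply cond_eq. intros eps Heps. rewrite Rminus_0_r.
  destruct (g_cont (eps / (4 * PI))) as [d [Hd H]].
  { apply Rdiv_lt_0_compat; lra. }
  (* The logarithm of a radius below [d], on which [g] is close to [g a]. *)
  set (s := Rmin t (ln (d / 2))).
  assert (Hs : exp s < d).
  { apply Rle_lt_trans with (exp (ln (d / 2))); [|rewrite exp_ln; lra].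
    unfold s. destruct (Req_dec (Rmin t (ln (d / 2))) (ln (d / 2))) as [->|]; [lra|].
    apply Rlt_le, exp_increasing. assert (X := Rmin_r t (ln (d / 2))). lra. }
  assert (Hst : s <= t) by apply Rmin_l.
  assert (Hsr : exp s < r).
  { apply Rle_lt_trans with (2 := Ht). destruct (Req_dec s t) as [->|]; [lra|].
    apply Rlt_le, exp_increasing. lra. }
  rewrite <- (polar_RInt_const s t Hst Ht).
  replace (2 * PI) with (2 * PI - 0) at 2 by ring.
  apply Rle_lt_trans with (eps / (4 * PI) * (2 * PI - 0)).
  - apply RInt_near_const; [lra|now apply ex_RInt_polar|].
    intros y _. apply Rlt_le.
    refine (Rle_lt_trans _ _ _ (re_le_Cmod (g (a + cexp (s, y)) - g a)%C) _).
    apply H. replace (a + cexp (s, y) - a)%C with (cexp (s, y)) by ring.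
    rewrite Cmod_cexp. exact Hs.
  - replace (eps / (4 * PI) * (2 * PI - 0)) with (eps / 2) by (field; lra). lra.
Qed.

Lemma mean_value_not_below (rho eta : R) : 0 < rho < r -> 0 < eta ->
  exists w, Cmod (w - a)%C = rho /\ Re (g a) - eta < Re (g w).
Proof.
  intros Hrho Heta. assert (P := PI_RGT_0). apply NNPP. intros No.
  assert (Ht : exp (ln rho) < r) by (rewrite exp_ln; lra).
  assert (M := mean_value (ln rho) Ht).
  assert (L : RInt (fun y => Re (g (a + cexp (ln rho, y))%C)) 0 (2 * PI)
              <= RInt (fun _ => Re (g a) - eta) 0 (2 * PI)).
  { apply RInt_le; [lra|now apply ex_RInt_polar|apply ex_RInt_const|].
    intros y _. apply Rnot_lt_le. intros Hy. apply No.
    exists (a + cexp (ln rho, y))%C. split; [|exact Hy].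
    replace (a + cexp (ln rho, y) - a)%C with (cexp (ln rho, y)) by ring.
    rewrite Cmod_cexp. cbn. apply exp_ln. lra. }
  rewrite M, RInt_const in L.
  change (Re (g a) * (2 * PI) <= (2 * PI - 0) * (Re (g a) - eta)) in L. nra.
Qed.
End MeanValue.

(** * Extreme values on a closed disc *)

Lemma locally_bounded_disc (F : C -> R) (r : R) :
  (forall z, Cmod z <= r -> exists d B, 0 < d /\
     forall w, Cmod (w - z)%C < d -> Cmod w <= r -> F w <= B) ->
  exists B, forall w, Cmod w <= r -> F w <= B.
Proof.
  intros H.
  assert (D : forall x y, exists e : posreal, forall w,
    Rabs (Re w - x) < e -> Rabs (Im w - y) < e -> Cmod w <= r -> F w <= / e).
  { intros x y. destruct (Rle_lt_dec (Cmod (x, y)) r) as [Hz|Hz].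
    - destruct (H (x, y) Hz) as [d [B [Hd HB]]].
      assert (He : 0 < Rmin (d / 2) (/ (Rabs B + 1))).
      { apply Rmin_pos; [lra|]. apply Rinv_0_lt_compat. assert (X := Rabs_pos B). lra. }
      exists (mkposreal _ He). cbn [pos]. intros w Hx Hy Hw.
      apply Rmin_Rgt in Hx as [Hx _]. apply Rmin_Rgt in Hy as [Hy _].
      apply Rle_trans with B.
      + apply HB; [|exact Hw]. apply Rle_lt_trans with (1 := Cmod_le_abs _).
        destruct w as [w1 w2]; unfold Re, Im in *; cbn in *. unfold Rminus in *. lra.
      + apply Rle_trans with (Rabs B + 1); [assert (X := Rle_abs B); lra|].
        rewrite <- (Rinv_inv (Rabs B + 1)) at 1.
        apply Rinv_le_contravar; [exact He|apply Rmin_r].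
    - assert (He : 0 < (Cmod (x, y) - r) / 2) by lra.
      exists (mkposreal _ He). cbn [pos]. intros w Hx Hy Hw. exfalso.
      assert (T := Cmod_triangle ((x, y) - w)%C w).
      replace ((x, y) - w + w)%C with ((x, y) : C) in T
        by (apply injective_projections; cbn; ring).
      assert (T' := Cmod_le_abs ((x, y) - w)%C).
      destruct w as [w1 w2]; unfold Re, Im in *; cbn in *.
      rewrite (Rabs_minus_sym w1), (Rabs_minus_sym w2) in *. unfold Rminus in *. lra. }
  set (e := fun x y => proj1_sig (constructive_indefinite_description _ (D x y))).
  assert (He : forall x y w, Rabs (Re w - x) < e x y -> Rabs (Im w - y) < e x y ->
    Cmod w <= r -> F w <= / e x y).
  { intros x y. unfold e. now destruct (constructive_indefinite_description _ _). }
  destruct (compactness_value_2d (- r) r (- r) r e) as [d Hd].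
  exists (/ d). intros w Hw.
  assert (W1 := re_le_Cmod w). assert (W2 := im_le_Cmod w).
  apply Rabs_le_between in W1. apply Rabs_le_between in W2.
  apply NNPP. intros N. apply (Hd (Re w) (Im w)); try lra.
  intros [u [v [_ [_ [Hu [Hv Hduv]]]]]]. apply N.
  apply Rle_trans with (1 := He u v w Hu Hv Hw).
  apply Rinv_le_contravar; [apply cond_pos|exact Hduv].
Qed.

(** Were the supremum [S] not attained, [1 / (S - v)] would be locally bounded,
    hence bounded, and [S] could be lowered. *)
Lemma disc_extreme_value (v : C -> R) (r : R) : 0 <= r ->
  (forall z, Cmod z <= r -> forall eps, 0 < eps -> exists d, 0 < d /\
     forall w, Cmod (w - z)%C < d -> Rabs (v w - v z) < eps) ->
  exists b, Cmod b <= r /\ forall w, Cmod w <= r -> v w <= v b.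
Proof.
  intros Hr Hv.
  destruct (locally_bounded_disc v r) as [B HB].
  { intros z Hz. destruct (Hv z Hz 1 Rlt_0_1) as [d [Hd H]].
    exists d, (v z + 1); split; [exact Hd|]. intros w Hw _.
    specialize (H w Hw). apply Rabs_def2 in H. lra. }
  destruct (completeness (fun t => exists w, Cmod w <= r /\ t = v w)) as [S [HS1 HS2]].
  { exists B. intros t [w [Hw ->]]. auto. }
  { exists (v 0). exists (RtoC 0). rewrite Cmod_0. auto. }
  assert (HS : forall w, Cmod w <= r -> v w <= S) by (intros w Hw; apply HS1; eauto).
  apply NNPP. intros No.
  assert (Lt : forall w, Cmod w <= r -> v w < S).
  { intros w Hw. destruct (HS w Hw) as [|E]; [assumption|]. exfalso. apply No.
    exists w. rewrite E. auto. }
  destruct (locally_bounded_disc (fun w => / (S - v w)) r) as [K HK].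
  { intros z Hz. specialize (Lt z Hz).
    destruct (Hv z Hz ((S - v z) / 2)) as [d [Hd H]]; [lra|].
    exists d, (/ ((S - v z) / 2)); split; [exact Hd|]. intros w Hw _.
    specialize (H w Hw). apply Rabs_def2 in H. apply Rinv_le_contravar; lra. }
  assert (HK0 : 0 < K).
  { assert (H0 : Cmod (RtoC 0) <= r) by (rewrite Cmod_0; exact Hr).
    apply Rlt_le_trans with (2 := HK _ H0). apply Rinv_0_lt_compat.
    specialize (Lt _ H0). lra. }
  assert (PK := Rinv_0_lt_compat _ HK0).
  assert (S <= S - / K); [|lra].
  apply HS2. intros t [w [Hw ->]]. specialize (HK w Hw). specialize (Lt w Hw).
  assert (/ K <= S - v w); [|lra].
  rewrite <- (Rinv_inv (S - v w)) at 1. apply Rinv_le_contravar; [|exact HK].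
  apply Rinv_0_lt_compat. lra.
Qed.

(** * The maximum principle and the Schwarz lemma *)

(** The quotients [g w / w] of the Schwarz lemma have this form without any theorem
    on removable singularities, and the class is stable under automorphisms of the
    disc, which move the exceptional point away from the origin. *)
Definition almost_holomorphic (q : C -> C) : Prop :=
  forall a, unit_disc a -> ccont q a /\
    exists r, 0 < r /\ forall w, 0 < Cmod (w - a)%C < r -> cdiff q w.

(** Adding [eps * |w|^2] makes an interior maximum impossible: the mean over a
    small circle of radius [rho] exceeds the value at the centre by
    [eps * rho^2]. *)
Lemma Re_max_principle (q : C -> C) (r eps M : R) (z : C) :
  almost_holomorphic q -> 0 < r < 1 -> 0 < eps ->
  (forall w, Cmod w = r -> Re (q w) <= M) -> Cmod z <= r ->
  Re (q z) <= M + eps * r ^ 2.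
Proof.
  intros Hq Hr Heps HM Hz.
  set (v := fun w => Re (q w) + eps * Cmod w ^ 2).
  destruct (disc_extreme_value v r) as [b [Hb Hmax]]; [lra| |].
  { intros w Hw e He.
    destruct (Hq w) as [Hc _]; [unfold unit_disc; lra|].
    destruct (Hc (e / 2)) as [d [Hd H]]; [lra|].
    assert (He4 : 0 < e / (8 * eps)) by (apply Rdiv_lt_0_compat; lra).
    exists (Rmin d (Rmin 1 (e / (8 * eps)))); split; [repeat apply Rmin_pos; lra|].
    intros w' Hw'. apply Rmin_Rgt in Hw' as [H1 H2]. apply Rmin_Rgt in H2 as [H2 H3].
    specialize (H w' H1).
    assert (R1 := Rle_lt_trans _ _ _ (re_le_Cmod (q w' - q w)%C) H).
    assert (R2 := Cmod_sub_abs w' w).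
    unfold v.
    replace (Re (q w') + eps * Cmod w' ^ 2 - (Re (q w) + eps * Cmod w ^ 2))
      with (Re (q w' - q w)%C + eps * ((Cmod w' - Cmod w) * (Cmod w' + Cmod w)))
      by (unfold Re; cbn; ring).
    apply Rle_lt_trans with (1 := Rabs_triang _ _).
    assert (N := Cmod_ge_0 w). assert (N' := Cmod_ge_0 w').
    assert (Hw3 : Cmod w' + Cmod w <= 3).
    { apply Rabs_le_between in R2. lra. }
    rewrite Rabs_mult, Rabs_pos_eq with (x := eps) by lra.
    rewrite Rabs_mult, Rabs_pos_eq with (x := Cmod w' + Cmod w) by lra.
    assert (B : Rabs (Cmod w' - Cmod w) * (Cmod w' + Cmod w) <= e / (8 * eps) * 3).
    { apply Rmult_le_compat; try lra. apply Rabs_pos. }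
    apply (Rmult_le_compat_l eps) in B; [|lra].
    replace (eps * (e / (8 * eps) * 3)) with (3 / 8 * e) in B by (field; lra). lra. }
  assert (Hzb := Hmax z Hz). unfold v in Hzb at 1.
  assert (P := pow2_ge_0 (Cmod z)).
  destruct Hb as [Hb|Hb].
  2:{ unfold v in Hzb. rewrite Hb in Hzb. specialize (HM b Hb). nra. }
  exfalso. clear z Hz Hzb P.
  destruct (Hq b) as [Hc [rb [Hrb Hd]]]; [unfold unit_disc; lra|].
  (* On a circle around [b], [v] differs from the real part of [h] by a constant,
     since [|w|^2 = |w - b|^2 + 2 Re (Cconj b * w) - |b|^2]. *)
  set (h := fun w => (q w + 2 * eps * Cconj b * w)%C).
  set (rho := Rmin rb (r - Cmod b) / 2).
  assert (M0 := Rmin_pos rb (r - Cmod b) Hrb ltac:(lra)).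
  assert (Hrho : 0 < rho < rb).
  { unfold rho. assert (M1 := Rmin_l rb (r - Cmod b)). lra. }
  assert (Hrho' : rho < r - Cmod b).
  { unfold rho. assert (M1 := Rmin_r rb (r - Cmod b)). lra. }
  destruct (mean_value_not_below h b rb) with (rho := rho) (eta := eps * rho ^ 2)
    as [w [Hw Hlt]]; auto.
  - intros w Hw. apply cdiff_plus; [now apply Hd|].
    apply cdiff_mult; [apply cdiff_const|apply cdiff_id].
  - apply ccont_plus; [exact Hc|]. apply ccont_mult; [apply ccont_const|apply ccont_id].
  - apply Rmult_lt_0_compat; [lra|]. apply pow_lt. lra.
  - assert (Hwr : Cmod w <= r).
    { assert (T := Cmod_sub_ge w b). lra. }
    assert (Hv := Hmax w Hwr). unfold v in Hv.
    assert (S1 := Cmod_sq (w - b)%C). rewrite Hw in S1.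
    rewrite (Cmod_sq w), (Cmod_sq b) in Hv. unfold h in Hlt.
    rewrite S1 in Hlt. destruct w as [w1 w2], b as [b1 b2].
    unfold Re, Cconj, Cmult, Cplus, Cminus, RtoC in *; cbn -[pow] in *. nra.
Qed.

Lemma almost_holomorphic_cmul (c : C) (q : C -> C) :
  almost_holomorphic q -> almost_holomorphic (fun w => c * q w)%C.
Proof.
  intros Hq a Ha. destruct (Hq a Ha) as [Hc [r [Hr Hd]]]. split.
  - apply ccont_mult; [apply ccont_const|exact Hc].
  - exists r; split; [exact Hr|]. intros w Hw.
    apply cdiff_mult; [apply cdiff_const|auto].
Qed.

(** A rotation turns the modulus at [z] into a real part. *)
Lemma max_principle (q : C -> C) (r M : R) (z : C) :
  almost_holomorphic q -> 0 < r < 1 ->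
  (forall w, Cmod w = r -> Cmod (q w) <= M) -> Cmod z <= r -> Cmod (q z) <= M.
Proof.
  intros Hq Hr HM Hz.
  destruct (classic (q z = RtoC 0)) as [E|N].
  { rewrite E, Cmod_0. apply Rle_trans with (2 := HM r ltac:(rewrite Cmod_R, Rabs_pos_eq; lra)).
    apply Cmod_ge_0. }
  assert (P := proj1 (Cmod_gt_0 _) N).
  set (c := (Cconj (q z) / Cmod (q z))%C).
  assert (HP : RtoC (Cmod (q z)) <> RtoC 0) by (intros E; apply RtoC_inj in E; lra).
  assert (Hc : Cmod c = 1).
  { unfold c. rewrite Cmod_div by exact HP. rewrite Cmod_conj, Cmod_R, Rabs_pos_eq by lra.
    field. lra. }
  assert (Hcq : (c * q z)%C = RtoC (Cmod (q z))).
  { unfold c. replace (Cconj (q z) / Cmod (q z) * q z)%C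
      with (q z * Cconj (q z) / Cmod (q z))%C by (field; exact HP).
    rewrite <- Cmod2_conj. rewrite RtoC_pow. field. exact HP. }
  apply (le_of_forall_eps _ _ (r ^ 2)); [apply pow2_ge_0|]. intros eps Heps.
  replace (Cmod (q z)) with (Re (c * q z)%C) by (rewrite Hcq; reflexivity).
  apply (Re_max_principle (fun w => c * q w)%C); auto.
  - now apply almost_holomorphic_cmul.
  - intros w Hw. apply Rle_trans with (Cmod (c * q w)%C).
    + apply Rle_trans with (2 := re_le_Cmod _). apply Rle_abs.
    + rewrite Cmod_mult, Hc, Rmult_1_l. auto.
Qed.

(** The Schwarz lemma, with the quotient [g w / w] kept as a function so that
    Schwarz-Pick can be applied to it in turn. The maximum principle on circles of
    radius close to [1] bounds it by [1]. *)
Lemma schwarz_factor (g : C -> C) :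
  almost_holomorphic g -> (forall w, unit_disc w -> Cmod (g w) <= 1) ->
  g 0 = RtoC 0 -> cdiff g 0 ->
  exists q, almost_holomorphic q /\ (forall w, unit_disc w -> Cmod (q w) <= 1) /\
    (forall w, g w = w * q w)%C /\ (forall w, w <> RtoC 0 -> cdiff g w -> cdiff q w).
Proof.
  intros Hg Hb H0 [q [Hq E]]. exists q.
  assert (E' : forall w, g w = (w * q w)%C).
  { intros w. specialize (E w). rewrite H0 in E.
    replace (g w) with (g w - 0)%C by ring. rewrite E. ring. }
  assert (Loc : forall w, w <> RtoC 0 -> forall w', Cmod (w' - w)%C < Cmod w ->
    (/ w' * g w')%C = q w').
  { intros w Hw w' H. rewrite E'. field. intros ->.
    replace (0 - w)%C with (- w)%C in H by ring. rewrite Cmod_opp in H. lra. }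
  assert (D : forall w, w <> RtoC 0 -> cdiff g w -> cdiff q w).
  { intros w Hw Hd. assert (P := proj1 (Cmod_gt_0 _) Hw).
    apply cdiff_ext_loc with (2 := Loc w Hw); [exact P|].
    apply cdiff_mult; [|exact Hd]. apply (cdiff_inv (fun w => w)); [apply cdiff_id|exact Hw]. }
  assert (A : almost_holomorphic q).
  { intros a Ha. destruct (Hg a Ha) as [Hc [r [Hr Hd]]].
    destruct (classic (a = RtoC 0)) as [->|Na].
    - split; [exact Hq|]. exists r; split; [exact Hr|]. intros w Hw.
      apply D; [|now apply Hd]. intros ->. replace (0 - 0)%C with (RtoC 0) in Hw by ring.
      rewrite Cmod_0 in Hw. lra.
    - assert (P := proj1 (Cmod_gt_0 _) Na). split.
      + apply ccont_ext_loc with (2 := Loc a Na); [exact P|].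
        apply ccont_mult; [|exact Hc]. apply (ccont_inv (fun w => w)); [apply ccont_id|exact Na].
      + exists (Rmin r (Cmod a)); split; [now apply Rmin_pos|]. intros w [Hw1 Hw2].
        apply Rmin_Rgt in Hw2 as [Hw2 Hw3]. apply D; [|apply Hd; lra].
        intros ->. replace (0 - a)%C with (- a)%C in Hw3 by ring. rewrite Cmod_opp in Hw3. lra. }
  split; [exact A|split; [|split; assumption]].
  intros w Hw. unfold unit_disc in Hw. apply Rnot_lt_le. intros Hlt.
  assert (Nw := Cmod_ge_0 w).
  set (m := Cmod (q w)) in *.
  (* A radius [r < 1] with [|w| <= r] and [1 / r < m]. *)
  set (r := Rmax ((1 + Cmod w) / 2) ((1 + / m) / 2)).
  assert (Hm : / m < 1) by (rewrite <- Rinv_1; apply Rinv_lt_contravar; lra).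
  assert (Hm0 : 0 < / m) by (apply Rinv_0_lt_compat; lra).
  assert (Hr : 0 < r < 1).
  { unfold r. split; [|apply Rmax_lub_lt; lra].
    apply Rlt_le_trans with (2 := Rmax_l _ _). lra. }
  assert (L1 : Cmod w <= r) by (apply Rle_trans with (2 := Rmax_l _ _); lra).
  assert (L2 : / m < r) by (apply Rlt_le_trans with (2 := Rmax_r _ _); lra).
  assert (K : m <= / r).
  { apply (max_principle q r); auto. intros w' Hw'.
    specialize (Hb w'). unfold unit_disc in Hb. rewrite E', Cmod_mult, Hw' in Hb.
    apply Rmult_le_reg_l with r; [lra|]. rewrite Rinv_r by lra. apply Hb. lra. }
  apply Rinv_lt_contravar in L2; [|apply Rmult_lt_0_compat; lra].
  rewrite Rinv_inv in L2. lra.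
Qed.

(** * The pseudo-hyperbolic distance *)

Definition mobius (a z : C) : C := ((z - a) / (1 - Cconj a * z))%C.

(** The pseudo-hyperbolic distance of the disc. *)
Definition pdist (z w : C) : R := Cmod (mobius w z).

Lemma mobius_denominator (a z : C) : unit_disc a -> unit_disc z ->
  (1 - Cconj a * z)%C <> RtoC 0.
Proof.
  unfold unit_disc. intros Ha Hz. apply Cmod_gt_0.
  assert (T := Cmod_sub_ge 1 (Cconj a * z)%C). rewrite Cmod_1, Cmod_mult, Cmod_conj in T.
  assert (Pa := Cmod_ge_0 a). assert (Pz := Cmod_ge_0 z). nra.
Qed.

Lemma mobius_denominator_ge (a z : C) :
  1 - Cmod a * Cmod z <= Cmod (1 - Cconj a * z)%C.
Proof.
  assert (T := Cmod_sub_ge 1 (Cconj a * z)%C). now rewrite Cmod_1, Cmod_mult, Cmod_conj in T.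
Qed.

Lemma mobius_defect (a z : C) :
  Cmod (1 - Cconj a * z)%C ^ 2 - Cmod (z - a)%C ^ 2 = (1 - Cmod a ^ 2) * (1 - Cmod z ^ 2).
Proof.
  rewrite !Cmod_sq. destruct a as [a1 a2], z as [z1 z2]. cbn. ring.
Qed.

Lemma pdist_mult (z a : C) : unit_disc a -> unit_disc z ->
  Cmod (z - a)%C = pdist z a * Cmod (1 - Cconj a * z)%C.
Proof.
  intros Ha Hz. unfold pdist, mobius.
  rewrite <- Cmod_mult. f_equal. field. now apply mobius_denominator.
Qed.

Lemma pdist_defect (z a : C) : unit_disc a -> unit_disc z ->
  (1 - pdist z a ^ 2) * Cmod (1 - Cconj a * z)%C ^ 2 = (1 - Cmod a ^ 2) * (1 - Cmod z ^ 2).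
Proof.
  intros Ha Hz. rewrite <- mobius_defect, (pdist_mult z a Ha Hz). ring.
Qed.

Lemma pdist_ge_0 (z a : C) : 0 <= pdist z a.
Proof. apply Cmod_ge_0. Qed.

Lemma unit_disc_sq (z : C) : unit_disc z -> 0 < 1 - Cmod z ^ 2.
Proof. unfold unit_disc. intros H. assert (P := Cmod_ge_0 z). nra. Qed.

Lemma pdist_lt_1 (z a : C) : unit_disc a -> unit_disc z -> pdist z a < 1.
Proof.
  intros Ha Hz. assert (D := pdist_defect z a Ha Hz). assert (P := pdist_ge_0 z a).
  assert (Q := Rmult_lt_0_compat _ _ (unit_disc_sq a Ha) (unit_disc_sq z Hz)).
  assert (K := pow2_ge_0 (Cmod (1 - Cconj a * z)%C)).
  apply Rnot_le_lt. intros H. assert (1 - pdist z a ^ 2 <= 0) by nra. nra.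
Qed.

Lemma pdist_self (z : C) : pdist z z = 0.
Proof.
  unfold pdist, mobius. replace (z - z)%C with (RtoC 0) by ring.
  unfold Cdiv. now rewrite Cmult_0_l, Cmod_0.
Qed.

Lemma mobius_disc (a z : C) : unit_disc a -> unit_disc z -> unit_disc (mobius a z).
Proof. intros Ha Hz. exact (pdist_lt_1 z a Ha Hz). Qed.

Lemma unit_disc_opp (a : C) : unit_disc a -> unit_disc (- a)%C.
Proof. unfold unit_disc. now rewrite Cmod_opp. Qed.

Lemma mobius_cancel (a z : C) : unit_disc a -> unit_disc z -> mobius (- a)%C (mobius a z) = z.
Proof.
  intros Ha Hz. assert (N := mobius_denominator a z Ha Hz).
  assert (N' := mobius_denominator a a Ha Ha).
  unfold mobius. rewrite Copp_conj. field. split; [exact N|].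
  intros E. apply N'. rewrite <- E. ring.
Qed.

Lemma cdiff_mobius (a z : C) : unit_disc a -> unit_disc z -> cdiff (mobius a) z.
Proof.
  intros Ha Hz. unfold mobius, Cdiv. apply cdiff_mult.
  - apply cdiff_plus; [apply cdiff_id|apply cdiff_const].
  - apply (cdiff_inv (fun z => 1 - Cconj a * z)%C); [|now apply mobius_denominator].
    apply cdiff_ext_loc with (f := fun w => (1 + - Cconj a * w)%C) (r := 1); [lra| |].
    { intros w _. ring. }
    apply cdiff_plus; [apply cdiff_const|].
    apply cdiff_mult; [apply cdiff_const|apply cdiff_id].
Qed.

Lemma unit_disc_0 : unit_disc 0.
Proof. unfold unit_disc. rewrite Cmod_0. lra. Qed.

Lemma mobius_0 (a : C) : mobius (- a)%C 0 = a.
Proof.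
  unfold mobius. rewrite Copp_conj. field.
Qed.

Lemma unit_disc_nearby (a w : C) : Cmod (w - a)%C < 1 - Cmod a -> unit_disc w.
Proof.
  unfold unit_disc. intros Hw. assert (T := Cmod_sub_ge w a). lra.
Qed.

Lemma almost_holomorphic_mobius (a b : C) (g : C -> C) :
  unit_disc a -> unit_disc b -> almost_holomorphic g -> self_map unit_disc g ->
  almost_holomorphic (fun w => mobius b (g (mobius a w))).
Proof.
  intros Ha Hb Hg Hs z Hz. assert (Hm := mobius_disc a z Ha Hz).
  destruct (Hg _ Hm) as [Hc [r [Hr Hd]]].
  assert (Cm := cdiff_ccont _ _ (cdiff_mobius a z Ha Hz)). split.
  - apply (ccont_comp (mobius b) (fun w => g (mobius a w))).
    + now apply ccont_comp.
    + apply cdiff_ccont, cdiff_mobius; auto.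
  - destruct (Cm r Hr) as [d [Hd0 H]].
    assert (P : 0 < 1 - Cmod z) by (unfold unit_disc in Hz; lra).
    exists (Rmin d (1 - Cmod z)); split; [now apply Rmin_pos|]. intros w [Hw1 Hw].
    apply Rmin_Rgt in Hw as [Hw2 Hw3].
    assert (Hw := unit_disc_nearby z w Hw3).
    apply (cdiff_comp (mobius b) (fun w => g (mobius a w))).
    + apply (cdiff_comp g (mobius a)); [now apply cdiff_mobius|].
      apply Hd. split; [|now apply H]. apply Cmod_gt_0, Cminus_neq_0. intros E.
      rewrite <- (mobius_cancel a w), <- (mobius_cancel a z), E in Hw1 by assumption.
      replace (mobius (- a)%C (mobius a z) - mobius (- a)%C (mobius a z))%C
        with (RtoC 0) in Hw1 by ring. rewrite Cmod_0 in Hw1. lra.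
    + apply cdiff_mobius; [exact Hb|]. apply Hs. now apply mobius_disc.
Qed.

(** Conjugate by the automorphisms that send [a] and [g a] to the origin, then
    apply the Schwarz lemma. *)
Lemma schwarz_pick_factor (g : C -> C) (a : C) :
  almost_holomorphic g -> self_map unit_disc g -> unit_disc a -> cdiff g a ->
  exists q, almost_holomorphic q /\ (forall w, unit_disc w -> Cmod (q w) <= 1) /\
    (forall z, unit_disc z -> mobius (g a) (g z) = mobius a z * q (mobius a z))%C /\
    (forall z, unit_disc z -> z <> a -> cdiff g z -> cdiff q (mobius a z)).
Proof.
  intros Hg Hs Ha Hd. assert (Hga := Hs a Ha). assert (Hoa := unit_disc_opp a Ha).
  destruct (schwarz_factor (fun w => mobius (g a) (g (mobius (- a)%C w))))
    as [q [Hq [Hb [E D]]]].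
  - now apply almost_holomorphic_mobius.
  - intros w Hw. apply Rlt_le. apply mobius_disc; [exact Hga|]. apply Hs.
    now apply mobius_disc.
  - rewrite mobius_0. unfold mobius. replace (g a - g a)%C with (RtoC 0) by ring.
    unfold Cdiv. ring.
  - apply (cdiff_comp (mobius (g a)) (fun w => g (mobius (- a)%C w))).
    + apply (cdiff_comp g (mobius (- a)%C)); [apply cdiff_mobius; auto using unit_disc_0|].
      now rewrite mobius_0.
    + rewrite mobius_0. now apply cdiff_mobius.
  - exists q. split; [exact Hq|]. split; [exact Hb|]. split.
    + intros z Hz. rewrite <- E, mobius_cancel; auto.
    + intros z Hz N Hgz. apply D.
      * intros E0. apply N. rewrite <- (mobius_cancel a z), E0 by assumption. apply mobius_0.
      * apply (cdiff_comp (mobius (g a)) (fun w => g (mobius (- a)%C w))).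
        -- apply (cdiff_comp g (mobius (- a)%C)).
           ++ apply cdiff_mobius; [exact Hoa|]. now apply mobius_disc.
           ++ now rewrite mobius_cancel.
        -- rewrite mobius_cancel by assumption. apply cdiff_mobius; auto.
Qed.

Lemma schwarz_pick (g : C -> C) (a z : C) :
  almost_holomorphic g -> self_map unit_disc g -> unit_disc a -> unit_disc z ->
  cdiff g a -> pdist (g z) (g a) <= pdist z a.
Proof.
  intros Hg Hs Ha Hz Hd.
  destruct (schwarz_pick_factor g a Hg Hs Ha Hd) as [q [_ [Hb [E _]]]].
  unfold pdist. rewrite E by exact Hz. rewrite Cmod_mult.
  rewrite <- (Rmult_1_r (Cmod (mobius a z))) at 2.
  apply Rmult_le_compat_l; [apply Cmod_ge_0|]. apply Hb. now apply mobius_disc.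
Qed.

(** By [pdist_defect], for given moduli [pdist] is smallest when
    [|1 - Cconj a * z|] is, that is, equal to [1 - |a| * |z|]; it is then
    [||a| - |z|| / (1 - |a| * |z|)]. *)
Lemma pdist_ge_diff (z a : C) : unit_disc a -> unit_disc z -> Cmod a - Cmod z <= pdist z a.
Proof.
  intros Ha Hz. assert (D := pdist_defect z a Ha Hz).
  assert (K := mobius_denominator_ge a z). assert (P := pdist_ge_0 z a).
  assert (Pa := Cmod_ge_0 a). assert (Pz := Cmod_ge_0 z). unfold unit_disc in *.
  set (A := Cmod a) in *. set (Z := Cmod z) in *. set (m := Cmod (1 - _)%C) in *.
  set (p := pdist z a) in *.
  apply Rnot_lt_le. intros H.
  assert (K0 : 0 < 1 - A * Z) by nra.
  assert (K2 : (1 - A * Z) ^ 2 <= m ^ 2) by (apply pow_incr; lra).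
  assert (S : p ^ 2 < (A - Z) ^ 2) by nra.
  assert (Q : (A - Z) ^ 2 <= 1) by nra.
  assert (X : (1 - (A - Z) ^ 2) * (1 - A * Z) ^ 2 <= (1 - (A - Z) ^ 2) * m ^ 2)
    by (apply Rmult_le_compat_l; lra).
  assert (Y : (1 - (A - Z) ^ 2) * m ^ 2 < (1 - p ^ 2) * m ^ 2).
  { apply Rmult_lt_compat_r; [|lra]. apply Rlt_le_trans with (2 := K2). now apply pow_lt. }
  rewrite D in Y.
  assert (W : (A - Z) ^ 2 * (1 - A * Z) ^ 2 <= (A - Z) ^ 2 * 1).
  { apply Rmult_le_compat_l; [apply pow2_ge_0|]. assert (0 <= A * Z) by nra. nra. }
  nra.
Qed.

(** Since [q] may reach the unit circle, Schwarz-Pick is applied to [l * q] with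
    [l < 1], and [l] is let tend to [1]. *)
Lemma modulus_drop_le_pdist (q : C -> C) (s w : C) :
  almost_holomorphic q -> (forall z, unit_disc z -> Cmod (q z) <= 1) ->
  unit_disc s -> unit_disc w -> cdiff q w -> Cmod (q w) - pdist s w <= Cmod (q s).
Proof.
  intros Hq Hb Hs Hw Hd.
  assert (L : forall l, 0 < l < 1 -> l * Cmod (q w) - l * Cmod (q s) <= pdist s w).
  { intros l Hl.
    assert (M : forall z, Cmod (l * q z)%C = l * Cmod (q z)).
    { intros z. rewrite Cmod_mult, Cmod_R, Rabs_pos_eq; lra. }
    assert (S : self_map unit_disc (fun z => l * q z)%C).
    { intros z Hz. unfold unit_disc. rewrite M. specialize (Hb z Hz).
      assert (P := Cmod_ge_0 (q z)). nra. }
    rewrite <- !M. apply Rle_trans with (pdist (l * q s)%C (l * q w)%C).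
    - apply pdist_ge_diff; [exact (S w Hw)|exact (S s Hs)].
    - apply (schwarz_pick (fun z => l * q z)%C); auto.
      + now apply almost_holomorphic_cmul.
      + apply cdiff_mult; [apply cdiff_const|exact Hd]. }
  apply Rnot_lt_le. intros H. assert (P := pdist_ge_0 s w).
  set (D := Cmod (q w) - Cmod (q s)) in *.
  assert (HD : pdist s w < D) by (unfold D; lra).
  (* Any [l < 1] with [l * D > pdist s w]. *)
  specialize (L ((1 + pdist s w / D) / 2)).
  assert (R1 : 0 <= pdist s w / D) by (apply Rdiv_le_0_compat; lra).
  assert (R2 : pdist s w / D < 1) by (apply Rlt_div_l; lra).
  specialize (L ltac:(lra)).
  replace ((1 + pdist s w / D) / 2 * Cmod (q w) - (1 + pdist s w / D) / 2 * Cmod (q s))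
    with ((D + pdist s w) / 2) in L; [lra|].
  unfold D. field. fold D. lra.
Qed.

(** Two points that stay away from the unit circle have distance bounded away
    from [1]. *)
Lemma pdist_le_bound (s w : C) : unit_disc s -> unit_disc w ->
  pdist s w <= 1 - (1 - Cmod s ^ 2) * (1 - Cmod w ^ 2) / 8.
Proof.
  intros Hs Hw. assert (D := pdist_defect s w Hw Hs). assert (P := pdist_ge_0 s w).
  assert (P1 := pdist_lt_1 s w Hw Hs).
  assert (T := Cmod_triangle 1 (- (Cconj w * s))%C).
  replace (1 + - (Cconj w * s))%C with (1 - Cconj w * s)%C in T by ring.
  rewrite Cmod_1, Cmod_opp, Cmod_mult, Cmod_conj in T. unfold unit_disc in *.
  assert (Ps := Cmod_ge_0 s). assert (Pw := Cmod_ge_0 w).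
  set (m := Cmod (1 - _)%C) in *. assert (Hm : 0 <= m) by apply Cmod_ge_0.
  assert (m <= 2) by nra. assert (m ^ 2 <= 4) by nra.
  set (p := pdist s w) in *. set (X := (1 - Cmod w ^ 2) * (1 - Cmod s ^ 2)) in *.
  replace ((1 - Cmod s ^ 2) * (1 - Cmod w ^ 2)) with X by (unfold X; ring).
  assert ((1 - p ^ 2) * m ^ 2 <= (1 - p ^ 2) * 4) by (apply Rmult_le_compat_l; nra). nra.
Qed.

Lemma cdiff_almost_holomorphic (g : C -> C) :
  (forall z, unit_disc z -> cdiff g z) -> almost_holomorphic g.
Proof.
  intros H a Ha. split; [apply cdiff_ccont; auto|].
  exists (1 - Cmod a). unfold unit_disc in Ha. split; [lra|].
  intros w [_ Hw]. apply H. now apply unit_disc_nearby with a.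
Qed.

(** If [g] almost preserves the distance from [a] to [b], the factor [q] of
    [schwarz_pick_factor] has modulus almost [1] at the point representing [b], so
    it cannot be small at the point representing [c]. *)
Lemma three_point_schwarz_pick (g : C -> C) (a b c : C) :
  self_map unit_disc g -> (forall z, unit_disc z -> cdiff g z) ->
  unit_disc a -> unit_disc b -> unit_disc c -> b <> a ->
  (pdist (g b) (g a) / pdist b a - (1 - (1 - pdist c a ^ 2) * (1 - pdist b a ^ 2) / 8))
    * pdist c a <= pdist (g c) (g a).
Proof.
  intros Hs Hd Ha Hb Hc N.
  destruct (schwarz_pick_factor g a (cdiff_almost_holomorphic g Hd) Hs Ha (Hd a Ha))
    as [q [Hq [Hq1 [E D]]]].
  assert (Mb := mobius_disc a b Ha Hb). assert (Mc := mobius_disc a c Ha Hc).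
  assert (M := modulus_drop_le_pdist q (mobius a c) (mobius a b) Hq Hq1 Mc Mb
                 (D b Hb N (Hd b Hb))).
  assert (B := pdist_le_bound (mobius a c) (mobius a b) Mc Mb).
  assert (Pb : 0 < pdist b a).
  { apply Cmod_gt_0. intros E0. apply N.
    rewrite <- (mobius_cancel a b), E0 by assumption. apply mobius_0. }
  replace (pdist (g b) (g a)) with (pdist b a * Cmod (q (mobius a b)))
    by (unfold pdist; now rewrite E, Cmod_mult).
  replace (pdist (g c) (g a)) with (pdist c a * Cmod (q (mobius a c)))
    by (unfold pdist; now rewrite E, Cmod_mult).
  replace (pdist b a * Cmod (q (mobius a b)) / pdist b a) with (Cmod (q (mobius a b)))
    by (field; lra).
  rewrite Rmult_comm. apply Rmult_le_compat_l; [apply pdist_ge_0|].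
  unfold pdist at 1 2. lra.
Qed.

(** A pseudo-hyperbolic ball around [z] lies in a Euclidean ball whose radius is
    comparable to the distance from [z] to the circle. *)
Lemma Cmod_sub_le_pdist (w z : C) (e : R) : unit_disc w -> unit_disc z ->
  pdist w z <= e -> e < 1 -> Cmod (w - z)%C <= 2 * e / (1 - e) * (1 - Cmod z).
Proof.
  intros Hw Hz He He1. assert (P := pdist_ge_0 w z).
  assert (M := pdist_mult w z Hz Hw).
  assert (T := Cmod_triangle (1 - Cconj z * z)%C (- (Cconj z * (w - z)))%C).
  replace (1 - Cconj z * z + - (Cconj z * (w - z)))%C with (1 - Cconj z * w)%C in T by ring.
  rewrite Cmod_opp, Cmod_mult, Cmod_conj in T.
  replace (1 - Cconj z * z)%C with (RtoC (1 - Cmod z ^ 2)) in T.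
  2:{ rewrite RtoC_minus, Cmod2_conj. ring. }
  assert (Q := unit_disc_sq z Hz). rewrite Cmod_R, Rabs_pos_eq in T by lra.
  unfold unit_disc in Hz. assert (Pz := Cmod_ge_0 z).
  assert (D := Cmod_ge_0 (w - z)%C).
  set (m := Cmod (1 - Cconj z * w)%C) in *. set (x := Cmod (w - z)%C) in *.
  assert (Hm : m <= 2 * (1 - Cmod z) + x) by nra.
  assert (X : x <= e * (2 * (1 - Cmod z) + x)).
  { rewrite M. apply Rmult_le_compat; try lra. apply Cmod_ge_0. }
  apply Rmult_le_reg_l with (1 - e); [lra|].
  replace ((1 - e) * (2 * e / (1 - e) * (1 - Cmod z))) with (2 * e * (1 - Cmod z))
    by (field; lra). lra.
Qed.

Lemma pdist_le_Cmod_sub (w z : C) : unit_disc w -> unit_disc z ->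
  pdist w z * (1 - Cmod z) <= Cmod (w - z)%C.
Proof.
  intros Hw Hz. rewrite (pdist_mult w z Hz Hw).
  apply Rmult_le_compat_l; [apply pdist_ge_0|].
  apply Rle_trans with (2 := mobius_denominator_ge z w).
  unfold unit_disc in *. assert (P := Cmod_ge_0 z). nra.
Qed.

(** * Iteration of a self-map of the disc *)

Lemma infimum_approached (u : nat -> R) (l : R) : (forall n, l <= u n) ->
  exists d, (forall n, d <= u n) /\ l <= d /\ forall e, d < e -> exists n, u n < e.
Proof.
  intros Hl.
  destruct (completeness (fun t => exists n, t = - u n)) as [S [H1 H2]].
  - exists (- l). intros t [n ->]. specialize (Hl n). lra.
  - exists (- u 0%nat). now exists 0%nat.
  - exists (- S). split; [|split].
    + intros n. specialize (H1 (- u n) ltac:(now exists n)). lra.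
    + assert (S <= - l); [|lra]. apply H2. intros t [n ->]. specialize (Hl n). lra.
    + intros e He. apply NNPP. intros N. assert (S <= - e); [|lra].
      apply H2. intros t [n ->]. apply Ropp_le_contravar, Rnot_lt_le.
      intros H. apply N. now exists n.
Qed.

Section Iteration.
Variable f : C -> C.
Hypothesis f_self : self_map unit_disc f.
Hypothesis f_diff : forall z, unit_disc z -> cdiff f z.

Lemma iter_self (n : nat) : self_map unit_disc (Nat.iter n f).
Proof. intros z Hz. induction n as [|n IH]; [exact Hz|]. now apply f_self. Qed.

Lemma iter_cdiff (n : nat) (z : C) : unit_disc z -> cdiff (Nat.iter n f) z.
Proof.
  intros Hz. induction n as [|n IH]; [apply cdiff_id|].
  apply (cdiff_comp f (Nat.iter n f)); [exact IH|]. apply f_diff. now apply iter_self.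
Qed.

Lemma pdist_iter_le (n : nat) (z w : C) : unit_disc z -> unit_disc w ->
  pdist (Nat.iter n f z) (Nat.iter n f w) <= pdist z w.
Proof.
  intros Hz Hw. apply schwarz_pick; auto using iter_self, iter_cdiff.
  apply cdiff_almost_holomorphic. auto using iter_cdiff.
Qed.

Lemma iter_shift (m k : nat) (z : C) : Nat.iter m f (Nat.iter k f z) = Nat.iter (m + k) f z.
Proof. symmetry. apply Nat.iter_add. Qed.

Lemma iter_succ (n : nat) (z : C) : Nat.iter n f (f z) = f (Nat.iter n f z).
Proof. apply Nat.iter_swap. Qed.

Lemma pdist_iter_decr (n m : nat) (z w : C) : (n <= m)%nat -> unit_disc z -> unit_disc w ->
  pdist (Nat.iter m f z) (Nat.iter m f w) <= pdist (Nat.iter n f z) (Nat.iter n f w).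
Proof.
  intros H Hz Hw. replace m with (m - n + n)%nat by lia.
  rewrite <- !iter_shift. apply pdist_iter_le; now apply iter_self.
Qed.

(** If the distances between the two orbits decreased to [d > 0], then from a time
    [k] on where they are close to [d], every iterate of [f] would almost preserve
    the distance between the two points at time [k]. By [three_point_schwarz_pick]
    the later steps would be at least a fixed fraction of the [k]-th one, which is
    not zero. *)
Lemma zero_step_orbits_merge (z0 w : C) :
  unit_disc z0 -> unit_disc w -> (forall z, unit_disc z -> f z <> z) ->
  (forall eps, 0 < eps -> exists n, pdist (Nat.iter n f (f z0)) (Nat.iter n f z0) < eps) ->
  forall eps, 0 < eps -> exists n, pdist (Nat.iter n f w) (Nat.iter n f z0) < eps.
Proof.
  intros Hz0 Hw Hfix Hstep eps Heps. apply NNPP. intros No.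
  assert (Hfz := f_self z0 Hz0).
  set (u := fun n => pdist (Nat.iter n f w) (Nat.iter n f z0)).
  set (s := fun n => pdist (Nat.iter n f (f z0)) (Nat.iter n f z0)).
  destruct (infimum_approached u eps) as [d [Hd1 [Hd2 Hd3]]].
  { intros n. apply Rnot_lt_le. intros H. apply No. now exists n. }
  assert (Hu0 : u 0%nat < 1) by now apply pdist_lt_1.
  assert (Hs0 : s 0%nat < 1) by now apply pdist_lt_1.
  assert (Pu0 : 0 <= u 0%nat) by apply pdist_ge_0.
  assert (Ps0 : 0 <= s 0%nat) by apply pdist_ge_0.
  (* By monotonicity, the value of [pdist_le_bound] at time [0] serves for all
     times. *)
  set (T := 1 - (1 - s 0%nat ^ 2) * (1 - u 0%nat ^ 2) / 8).
  assert (HT : 0 < T < 1).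
  { unfold T. assert (0 < 1 - s 0%nat ^ 2 <= 1) by nra.
    assert (0 < 1 - u 0%nat ^ 2 <= 1) by nra. nra. }
  (* From time [k] on, the ratio of distances stays above [(1 + T) / 2], which
     exceeds [T] by [(1 - T) / 2]. *)
  destruct (Hd3 (2 * d / (1 + T))) as [k Hk].
  { apply Rlt_div_r; [lra|]. nra. }
  assert (Iz := iter_self k z0 Hz0). assert (Iw := iter_self k w Hw).
  assert (If := iter_self k (f z0) Hfz).
  assert (Puk : 0 < u k) by (specialize (Hd1 k); lra).
  assert (Hsk : 0 < s k).
  { apply Rnot_le_lt. intros H. apply (Hfix _ Iz). rewrite <- iter_succ.
    rewrite <- (mobius_cancel (Nat.iter k f z0) (Nat.iter k f (f z0))) by assumption.
    rewrite (Cmod_eq_0 (mobius (Nat.iter k f z0) (Nat.iter k f (f z0)))); [apply mobius_0|].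
    apply Rle_antisym; [exact H|apply Cmod_ge_0]. }
  assert (Low : forall m, (1 - T) / 2 * s k <= s (m + k)%nat).
  { intros m.
    assert (N : Nat.iter k f w <> Nat.iter k f z0).
    { intros E. unfold u in Puk. rewrite E, pdist_self in Puk. lra. }
    assert (X := three_point_schwarz_pick (Nat.iter m f) _ _ _
      (iter_self m) (iter_cdiff m) Iz Iw If N).
    rewrite !iter_shift in X. fold (u k) (s k) (u (m + k)%nat) (s (m + k)%nat) in X.
    refine (Rle_trans _ _ _ _ X). apply Rmult_le_compat_r; [lra|].
    assert (Y : (1 + T) / 2 <= u (m + k)%nat / u k).
    { apply (Rle_div_r ((1 + T) / 2)); [lra|]. apply Rle_trans with (2 := Hd1 (m + k)%nat).
      apply Rlt_div_r in Hk; [|lra]. lra. }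
    assert (Z : 1 - (1 - s k ^ 2) * (1 - u k ^ 2) / 8 <= T); [|lra].
    assert (uk : u k <= u 0%nat) by (apply pdist_iter_decr; auto; lia).
    assert (sk : s k <= s 0%nat) by (apply pdist_iter_decr; auto; lia).
    unfold T.
    assert (B : (1 - s 0%nat ^ 2) * (1 - u 0%nat ^ 2) <= (1 - s k ^ 2) * (1 - u k ^ 2)).
    { apply Rmult_le_compat; nra. }
    lra. }
  destruct (Hstep ((1 - T) / 2 * s k)) as [n Hn].
  { apply Rmult_lt_0_compat; lra. }
  fold (s n) in Hn. specialize (Low n).
  assert (s (n + k)%nat <= s n) by (apply pdist_iter_decr; auto; lia). lra.
Qed.
End Iteration.

(** * Orbits that meet a Stolz region infinitely often *)

(** The real mean value theorem for the component of [F] along [F b - F a]; the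
    hypothesis says that [F] has at each point of the segment a derivative of
    modulus at most [B]. *)
Lemma segment_mean_value (F : C -> C) (a b : C) (B : R) :
  (forall t, 0 <= t <= 1 -> exists l, Cmod l <= B /\ forall eps, 0 < eps ->
     exists d, 0 < d /\ forall w, Cmod (w - (a + t * (b - a)))%C < d ->
       Cmod (F w - F (a + t * (b - a)) - (w - (a + t * (b - a))) * l)%C
         <= eps * Cmod (w - (a + t * (b - a)))%C) ->
  Cmod (F b - F a)%C <= B * Cmod (b - a)%C.
Proof.
  intros H.
  set (p := fun t : R => (a + t * (b - a))%C) in *.
  set (v := Cconj (F b - F a)%C).
  set (h := fun t => Re (v * F (p t))%C).
  assert (D : forall t, exists k, 0 <= t <= 1 ->
    derivable_pt_lim h t k /\ Rabs k <= Cmod v * (B * Cmod (b - a)%C)).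
  { intros t. destruct (classic (0 <= t <= 1)) as [Ht|Ht]; [|exists 0; tauto].
    destruct (H t Ht) as [l [Hl Ho]]. exists (Re (v * ((b - a) * l))%C). intros _. split.
    - intros eps Heps. set (c := Cmod v * Cmod (b - a)%C + 1).
      assert (Hc : 1 <= c).
      { unfold c. assert (X := Cmod_ge_0 v). assert (Y := Cmod_ge_0 (b - a)%C). nra. }
      destruct (Ho (eps / (2 * c))) as [d [Hd Hd']]; [apply Rdiv_lt_0_compat; lra|].
      assert (Hd2 : 0 < d / (Cmod (b - a)%C + 1)).
      { apply Rdiv_lt_0_compat; [lra|]. assert (Y := Cmod_ge_0 (b - a)%C). lra. }
      exists (mkposreal _ Hd2). cbn [pos]. intros x Hx0 Hx.
      assert (Px : 0 < Rabs x) by now apply Rabs_pos_lt.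
      assert (E : (p (t + x)%R - p t)%C = (x * (b - a))%C).
      { unfold p. rewrite RtoC_plus. ring. }
      assert (EM : Cmod (p (t + x)%R - p t)%C = Rabs x * Cmod (b - a)%C).
      { rewrite E, Cmod_mult, Cmod_R. reflexivity. }
      specialize (Hd' (p (t + x)%R)). fold (p t) in Hd'. rewrite EM in Hd'.
      assert (Yb := Cmod_ge_0 (b - a)%C). assert (Yv := Cmod_ge_0 v).
      assert (Hlt : Rabs x * Cmod (b - a)%C < d).
      { apply Rlt_div_r in Hx; [|lra]. nra. }
      specialize (Hd' Hlt). rewrite E in Hd'.
      apply Rmult_lt_reg_r with (Rabs x); [exact Px|].
      rewrite <- Rabs_mult.
      replace (((h (t + x) - h t) / x - Re (v * ((b - a) * l))%C) * x)
        with (Re (v * (F (p (t + x)%R) - F (p t) - x * (b - a) * l))%C).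
      2:{ unfold h. generalize (F (p (t + x)%R)), (F (p t)), (b - a)%C, v.
          intros X Y Z V. destruct X, Y, Z, V, l. unfold Re; cbn. field. exact Hx0. }
      apply Rle_lt_trans with (1 := re_le_Cmod _). rewrite Cmod_mult.
      apply Rle_lt_trans with (Cmod v * (eps / (2 * c) * (Rabs x * Cmod (b - a)%C))).
      { apply Rmult_le_compat_l; [exact Yv|exact Hd']. }
      replace (Cmod v * (eps / (2 * c) * (Rabs x * Cmod (b - a)%C)))
        with ((Cmod v * Cmod (b - a)%C) / c * (eps / 2 * Rabs x)) by (field; lra).
      assert (Q : Cmod v * Cmod (b - a)%C / c <= 1) by (apply Rle_div_l; [lra|unfold c; lra]).
      assert (0 < eps * Rabs x) by (apply Rmult_lt_0_compat; lra). nra.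
    - apply Rle_trans with (1 := re_le_Cmod _). rewrite !Cmod_mult.
      apply Rmult_le_compat_l; [apply Cmod_ge_0|]. rewrite Rmult_comm.
      apply Rmult_le_compat_r; [apply Cmod_ge_0|exact Hl]. }
  set (k := fun t => proj1_sig (constructive_indefinite_description _ (D t))).
  assert (Hk : forall t, 0 <= t <= 1 ->
    derivable_pt_lim h t (k t) /\ Rabs (k t) <= Cmod v * (B * Cmod (b - a)%C)).
  { intros t. unfold k. now destruct (constructive_indefinite_description _ _). }
  destruct (MVT_gen h 0 1 k) as [c [Hc E]].
  - intros t. rewrite Rmin_left, Rmax_right by lra. intros Ht.
    apply is_derive_Reals. apply Hk. lra.
  - intros t. rewrite Rmin_left, Rmax_right by lra. intros Ht.
    apply derivable_continuous_pt. exists (k t). apply Hk. lra.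
  - rewrite Rmin_left, Rmax_right in Hc by lra. destruct (Hk c Hc) as [_ Hb].
    assert (E1 : h 1 - h 0 = Cmod (F b - F a)%C ^ 2).
    { unfold h, p. replace (a + 1 * (b - a))%C with b by ring.
      replace (a + 0 * (b - a))%C with a by ring. rewrite Cmod_sq. unfold v.
      destruct (F b), (F a). unfold Re; cbn. ring. }
    rewrite E1 in E. unfold v in Hb. rewrite Cmod_conj in Hb.
    assert (X := Cmod_ge_0 (F b - F a)%C). assert (Y := Rle_abs (k c)).
    destruct X as [X|X]; [|rewrite <- X].
    + apply Rmult_le_reg_l with (1 := X). nra.
    + apply Rmult_le_pos; [|apply Cmod_ge_0].
      destruct (H 0 ltac:(lra)) as [l [Hl _]]. assert (Z := Cmod_ge_0 l). lra.
Qed.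

Lemma Cmod_segment_le (x a b : C) (t : R) : 0 <= t <= 1 ->
  Cmod (a + t * (b - a) - x)%C <= (1 - t) * Cmod (a - x)%C + t * Cmod (b - x)%C.
Proof.
  intros Ht.
  replace (a + t * (b - a) - x)%C with ((1 - t)%R * (a - x) + t * (b - x))%C
    by (rewrite RtoC_minus; ring).
  apply Rle_trans with (1 := Cmod_triangle _ _).
  rewrite !Cmod_mult, !Cmod_R, !Rabs_pos_eq by lra. lra.
Qed.

Lemma convex_combination_lt (t x x' y y' : R) : 0 <= t <= 1 -> x < x' -> y < y' ->
  (1 - t) * x + t * y < (1 - t) * x' + t * y'.
Proof. intros Ht Hx Hy. destruct (Rle_lt_dec t (1 / 2)); nra. Qed.

(** The region is defined by the convex function [|tau - z| + M * |z|]. *)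
Lemma stolz_region_convex (tau : C) (M t : R) (a b : C) : 0 <= M -> 0 <= t <= 1 ->
  stolz_region tau M a -> stolz_region tau M b -> stolz_region tau M (a + t * (b - a))%C.
Proof.
  unfold stolz_region, unit_disc. intros HM Ht [Ha Ha'] [Hb Hb'].
  assert (S0 := Cmod_segment_le 0 a b t Ht).
  assert (S1 := Cmod_segment_le tau a b t Ht).
  replace (a + t * (b - a) - 0)%C with (a + t * (b - a))%C in S0 by ring.
  replace (a - 0)%C with a in S0 by ring. replace (b - 0)%C with b in S0 by ring.
  rewrite (Cmod_sub_sym tau) in *. set (z := (a + t * (b - a))%C) in *.
  assert (L0 := convex_combination_lt t _ _ _ _ Ht Ha Hb).
  assert (L1 := convex_combination_lt t _ _ _ _ Ht Ha' Hb').
  split; [lra|]. apply (Rmult_le_compat_l M) in S0; [|exact HM]. lra.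
Qed.

Lemma derivative_near_boundary (f : C -> C) (tau : C) (M eps : R) :
  nontangential_limit (C_derive f) tau (RtoC 1) -> 1 < M -> 0 < eps ->
  exists eta, 0 < eta /\ forall z, stolz_region tau M z -> Cmod (z - tau)%C < eta ->
    Cmod (C_derive f z - 1)%C < eps.
Proof.
  intros H HM Heps.
  assert (L : locally (RtoC 1) (fun w => Cmod (w - 1)%C < eps)) by now apply Cmod_locally with eps.
  destruct (locally_Cmod tau _ (H M HM _ L)) as [eta [He Heta]].
  exists eta; split; [exact He|]. intros z Hz Hzt. exact (Heta z Hzt Hz).
Qed.

(** The mean value inequality for [f z - z], whose derivative is small near [tau]
    within the region. *)
Lemma near_translation_in_stolz (f : C -> C) (tau : C) (M eps : R) :
  holomorphic_on unit_disc f -> nontangential_limit (C_derive f) tau (RtoC 1) ->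
  1 < M -> 0 < eps ->
  exists eta, 0 < eta /\ forall a b, stolz_region tau M a -> stolz_region tau M b ->
    Cmod (a - tau)%C < eta -> Cmod (b - tau)%C < eta ->
    Cmod ((f b - b) - (f a - a))%C <= eps * Cmod (b - a)%C.
Proof.
  intros Hf H HM Heps.
  destruct (derivative_near_boundary f tau M eps H HM Heps) as [eta [He Heta]].
  exists eta; split; [exact He|]. intros a b Sa Sb Ha Hb.
  apply (segment_mean_value (fun z => f z - z)%C). intros t Ht.
  assert (Sz := stolz_region_convex tau M t a b ltac:(lra) Ht Sa Sb).
  assert (Bz := Cmod_segment_le tau a b t Ht).
  set (z := (a + t * (b - a))%C) in *.
  exists (C_derive f z - 1)%C. split.
  - apply Rlt_le, Heta; [exact Sz|]. apply Rle_lt_trans with (1 := Bz).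
    assert (L := convex_combination_lt t _ _ _ _ Ht Ha Hb). lra.
  - intros e Hepos.
    destruct (is_derive_little_o f z (C_derive f z)) with (eps := e) as [d [Hd Hd']]; auto.
    { apply C_derive_correct; [exact z|]. apply Hf. apply Sz. }
    exists d; split; [exact Hd|]. intros w Hw.
    replace (f w - w - (f z - z) - (w - z) * (C_derive f z - 1))%C
      with (f w - f z - (w - z) * C_derive f z)%C by ring. auto.
Qed.

(** At an index [n] with [z_n] in the Stolz region, compare the displacement
    [f z_n - z_n] with the displacement at a much later such index [m]: the latter
    tends to [0] since [z_m] and [f z_m] both tend to [tau]. *)
Lemma nontangential_orbit_zero_step (f : C -> C) (tau z0 : C) (c : R) :
  holomorphic_on unit_disc f -> self_map unit_disc f ->
  nontangential_limit (C_derive f) tau (RtoC 1) -> unit_disc z0 ->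
  (forall e, 0 < e -> exists N, forall n, (N <= n)%nat -> Cmod (Nat.iter n f z0 - tau)%C < e) ->
  0 < c ->
  (forall N, exists n, (N <= n)%nat /\
     c * Cmod (tau - Nat.iter n f z0)%C <= 1 - Cmod (Nat.iter n f z0)) ->
  forall eps, 0 < eps -> exists n, pdist (Nat.iter n f (f z0)) (Nat.iter n f z0) < eps.
Proof.
  intros Hf Hs Hnt Hz0 Hlim Hc Hinf eps Heps.
  set (z := fun n => Nat.iter n f z0) in *.
  assert (Hz : forall n, unit_disc (z n)) by (intros; now apply iter_self).
  (* The aperture must exceed [1 / c], and the region is defined by a strict
     inequality. *)
  set (M := 1 / c + 1).
  assert (HcM : 0 < 1 / c) by (apply Rdiv_lt_0_compat; lra).
  assert (HM : 1 < M) by (unfold M; lra).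
  assert (St : forall n, c * Cmod (tau - z n)%C <= 1 - Cmod (z n) -> stolz_region tau M (z n)).
  { intros n Hn. split; [apply Hz|]. specialize (Hz n). unfold unit_disc in Hz.
    apply Rle_lt_trans with (1 / c * (1 - Cmod (z n))); [|unfold M; nra].
    replace (Cmod (tau - z n)%C) with (1 / c * (c * Cmod (tau - z n)%C)) by (field; lra).
    apply Rmult_le_compat_l; lra. }
  assert (Hec : 0 < eps * c / 2) by (apply Rdiv_lt_0_compat; [apply Rmult_lt_0_compat|]; lra).
  destruct (near_translation_in_stolz f tau M (eps * c / 2) Hf Hnt HM Hec) as [eta [He Heta]].
  destruct (Hlim eta He) as [N HN]. destruct (Hinf N) as [n [HnN Hn]].
  fold (z n) in Hn.
  exists n. rewrite iter_succ. fold (z n).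
  assert (Hfz : unit_disc (f (z n))) by auto.
  assert (Main : Cmod (f (z n) - z n)%C <= eps * c / 2 * Cmod (tau - z n)%C).
  { apply (le_of_forall_eps _ _ (2 + eps * c / 2)); [lra|]. intros e Hepos.
    destruct (Hlim (Rmin e eta)) as [N' HN']; [now apply Rmin_pos|].
    destruct (Hinf N') as [m [HmN Hm]].
    assert (D1 := HN' m HmN). assert (D2 := HN' (S m) ltac:(lia)).
    apply Rmin_Rgt in D1 as [D1 D1']. apply Rmin_Rgt in D2 as [D2 _].
    change (e > Cmod (f (z m) - tau)%C) in D2. fold (z m) in D1, D1'.
    assert (X := Heta (z m) (z n) (St m Hm) (St n Hn) D1' (HN n HnN)).
    assert (T1 := Cmod_triangle (f (z n) - z n - (f (z m) - z m))%C
      ((f (z m) - tau) + (tau - z m))%C).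
    replace (f (z n) - z n - (f (z m) - z m) + (f (z m) - tau + (tau - z m)))%C
      with (f (z n) - z n)%C in T1 by ring.
    assert (T2 := Cmod_triangle (f (z m) - tau)%C (tau - z m)%C).
    rewrite (Cmod_sub_sym tau (z m)) in T2.
    assert (T3 := Cmod_triangle (z n - tau)%C (tau - z m)%C).
    replace (z n - tau + (tau - z m))%C with (z n - z m)%C in T3 by ring.
    rewrite (Cmod_sub_sym tau (z m)), (Cmod_sub_sym (z n) tau) in T3.
    apply (Rmult_le_compat_l (eps * c / 2)) in T3; [|lra].
    assert (eps * c / 2 * Cmod (z m - tau)%C <= eps * c / 2 * e)
      by (apply Rmult_le_compat_l; lra). lra. }
  assert (P := pdist_le_Cmod_sub (f (z n)) (z n) Hfz (Hz n)).
  assert (Hzn := Hz n). unfold unit_disc in Hzn.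
  apply Rmult_lt_reg_r with (1 - Cmod (z n)); [lra|].
  apply Rle_lt_trans with (1 := P). apply Rle_lt_trans with (1 := Main).
  replace (eps * c / 2 * Cmod (tau - z n)%C) with (eps / 2 * (c * Cmod (tau - z n)%C)) by field.
  apply Rle_lt_trans with (eps / 2 * (1 - Cmod (z n))); [apply Rmult_le_compat_l; lra|nra].
Qed.

(** * Compact sets and the Wolff point *)

(** Each neighbourhood comes with its own index; a finite subcover leaves finitely
    many indices, of which the largest serves for the whole set. *)
Lemma compact_eventually (K : C -> Prop) (Q : nat -> C -> Prop) : compact_set K ->
  (forall w, K w -> exists d, 0 < d /\
     eventually (fun n => forall z, K z -> Cmod (z - w)%C < d -> Q n z)) ->
  eventually (fun n => forall z, K z -> Q n z).
Proof.
  intros HK H.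
  destruct (HK (fun V => open V /\ eventually (fun n => forall z, K z -> V z -> Q n z)))
    as [s [Hs Hcov]].
  - tauto.
  - intros w Hw. destruct (H w Hw) as [d [Hd He]].
    exists (fun z => Cmod (z - w)%C < d). split; [split; [|exact He]|].
    + intros z Hz. apply Cmod_locally with (d := d - Cmod (z - w)%C); [lra|].
      intros z' Hz'. assert (T := Cmod_triangle (z' - z)%C (z - w)%C).
      replace (z' - z + (z - w))%C with (z' - w)%C in T by ring. lra.
    + replace (w - w)%C with (RtoC 0) by ring. now rewrite Cmod_0.
  - assert (E : eventually (fun n => forall V, In V s -> forall z, K z -> V z -> Q n z)).
    { clear Hcov. induction s as [|V s IH]; [exists 0%nat; now intros|].
      destruct (IH (fun V' HV' => Hs V' (or_intror HV'))) as [N1 H1].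
      destruct (proj2 (Hs V (or_introl eq_refl))) as [N2 H2].
      exists (Nat.max N1 N2). intros n Hn V' [<-|HV'] z Hz HVz.
      - apply H2; auto. lia.
      - apply (H1 n ltac:(lia) V'); auto. }
    destruct E as [N HN]. exists N. intros n Hn z Hz.
    destruct (Hcov z Hz) as [V [HV HVz]]. now apply (HN n Hn V).
Qed.

Lemma compact_singleton (z0 : C) : compact_set (fun z => z = z0).
Proof.
  intros F _ HF. destruct (HF z0 eq_refl) as [V [HV HVz]].
  exists (V :: nil)%list. split.
  - intros V' [<-|[]]. exact HV.
  - intros z ->. exists V. split; [now left|exact HVz].
Qed.

Lemma wolff_point_orbit (f : C -> C) (tau z0 : C) : wolff_point f tau -> unit_disc z0 ->
  forall e, 0 < e -> exists N, forall n, (N <= n)%nat -> Cmod (Nat.iter n f z0 - tau)%C < e.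
Proof.
  intros [_ H] Hz0 e He.
  destruct (H _ (compact_singleton z0) ltac:(now intros z ->) (mkposreal e He)) as [N HN].
  exists N. intros n Hn. now apply (HN n Hn).
Qed.

Lemma wolff_point_unique (f : C -> C) (tau tau' : C) :
  wolff_point f tau -> wolff_point f tau' -> tau = tau'.
Proof.
  intros H H'. apply NNPP. intros N. apply Cminus_neq_0, Cmod_gt_0 in N.
  destruct (wolff_point_orbit f tau 0 H unit_disc_0 (Cmod (tau - tau')%C / 2)) as [n Hn]; [lra|].
  destruct (wolff_point_orbit f tau' 0 H' unit_disc_0 (Cmod (tau - tau')%C / 2)) as [n' Hn'];
    [lra|].
  specialize (Hn (n + n')%nat ltac:(lia)). specialize (Hn' (n + n')%nat ltac:(lia)).
  set (x := Nat.iter (n + n') f (RtoC 0)) in *.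
  assert (T := Cmod_triangle (tau - x)%C (x - tau')%C).
  replace (tau - x + (x - tau'))%C with (tau - tau')%C in T by ring.
  rewrite (Cmod_sub_sym tau x) in T. lra.
Qed.

(** * Convergence of the quotients *)

(** The local estimate behind uniformity: [z] near [w] stays near [w] under
    iteration by Schwarz-Pick, so a bound for the orbit of [w] serves for a whole
    neighbourhood. *)
Lemma orbits_near_base_orbit (f : C -> C) (z0 w z : C) (e p : R) (n : nat) :
  self_map unit_disc f -> (forall z, unit_disc z -> cdiff f z) ->
  unit_disc z0 -> unit_disc w -> unit_disc z -> e < 1 -> p < 1 ->
  Cmod (z - w)%C <= e * (1 - Cmod w) ->
  pdist (Nat.iter n f w) (Nat.iter n f z0) <= p ->
  Cmod (Nat.iter n f z - Nat.iter n f z0)%C <=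
    (2 * e / (1 - e) * (1 + 2 * p / (1 - p)) + 2 * p / (1 - p)) * (1 - Cmod (Nat.iter n f z0)).
Proof.
  intros Hs Hd Hz0 Hw Hz He1 Hp1 Hzw Hp.
  assert (Hpz : pdist z w <= e).
  { assert (X := pdist_le_Cmod_sub z w Hz Hw). unfold unit_disc in Hw.
    apply Rmult_le_reg_r with (1 - Cmod w); lra. }
  assert (He0 := Rle_trans _ _ _ (pdist_ge_0 _ _) Hpz).
  assert (Hn := Rle_trans _ _ _ (pdist_iter_le f Hs Hd n z w Hz Hw) Hpz).
  assert (Iz := iter_self f Hs n z Hz). assert (Iw := iter_self f Hs n w Hw).
  assert (I0 := iter_self f Hs n z0 Hz0).
  assert (X := Cmod_sub_le_pdist _ _ e Iz Iw Hn He1).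
  assert (Y := Cmod_sub_le_pdist _ _ p Iw I0 Hp Hp1).
  set (a := Nat.iter n f w) in *. set (b := Nat.iter n f z) in *.
  set (c := Nat.iter n f z0) in *.
  assert (T := Cmod_triangle (b - a)%C (a - c)%C).
  replace (b - a + (a - c))%C with (b - c)%C in T by ring.
  assert (U := Cmod_sub_ge c a). rewrite (Cmod_sub_sym c a) in U.
  assert (K : 0 <= 2 * e / (1 - e)) by (apply Rdiv_le_0_compat; lra).
  set (k := 2 * e / (1 - e)) in *. set (k' := 2 * p / (1 - p)) in *.
  assert (k * (1 - Cmod a) <= k * ((1 + k') * (1 - Cmod c)))
    by (apply Rmult_le_compat_l; lra).
  lra.
Qed.

Theorem corollary8 (f : C -> C) (tau z0 : C)
  (f_holo : holomorphic_on unit_disc f)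
  (f_self : self_map unit_disc f)
  (f_parabolic : parabolic f)
  (tau_wolff : wolff_point f tau)
  (z0_disc : unit_disc z0) :
  cvg_unif_on_compacts unit_disc
    (fun n z => ((Nat.iter n f z - tau) / (Nat.iter n f z0 - tau))%C)
    (fun _ => RtoC 1).
Proof.
  destruct f_parabolic as [f_nofix [tau' [tau'_wolff f_nt]]].
  rewrite <- (wolff_point_unique f tau tau' tau_wolff tau'_wolff) in f_nt.
  assert (f_diff : forall z, unit_disc z -> cdiff f z)
    by (intros z Hz; now apply ex_derive_cdiff, f_holo).
  intros K K_compact K_disc eps.
  apply compact_eventually; [exact K_compact|]. intros w Kw.
  assert (Hw := K_disc w Kw). assert (Hw1 := Hw). unfold unit_disc in Hw1.
  assert (Htau := proj1 tau_wolff).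
  set (zeta := fun n => Nat.iter n f z0).
  assert (Hzeta : forall n, unit_disc (zeta n)) by (intros; now apply iter_self).
  assert (Pos : forall n, 1 - Cmod (zeta n) <= Cmod (tau - zeta n)%C).
  { intros n. rewrite <- Htau. apply Cmod_sub_ge. }
  assert (Reduce : forall n z, Cmod (Nat.iter n f z - zeta n)%C < eps * Cmod (tau - zeta n)%C ->
    Cmod ((Nat.iter n f z - tau) / (zeta n - tau) - 1)%C < eps).
  { intros n z H. assert (Pn := Pos n). assert (Hn := Hzeta n). unfold unit_disc in Hn.
    rewrite (Cmod_sub_sym tau) in *.
    assert (N : (zeta n - tau)%C <> RtoC 0) by (apply Cmod_gt_0; lra).
    replace ((Nat.iter n f z - tau) / (zeta n - tau) - 1)%C
      with ((Nat.iter n f z - zeta n) / (zeta n - tau))%C by (field; exact N).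
    rewrite Cmod_div by exact N. apply Rlt_div_l; lra. }
  assert (Heps := cond_pos eps).
  destruct (classic (exists c, 0 < c /\ forall N, exists n, (N <= n)%nat /\
     c * Cmod (tau - zeta n)%C <= 1 - Cmod (zeta n))) as [[c [Hc Hinf]]|Htan].
  (* The orbit meets a Stolz region infinitely often: the steps tend to [0] and all
     orbits merge. *)
  - set (k := Rmin eps 1 / 4).
    assert (Hk : 0 < k) by (unfold k; assert (X := Rmin_pos eps 1 Heps Rlt_0_1); lra).
    assert (Hk1 : k <= eps / 4) by (unfold k; assert (X := Rmin_l eps 1); lra).
    assert (Hk2 : k <= 1 / 4) by (unfold k; assert (X := Rmin_r eps 1); lra).
    (* Solves [2 * e / (1 - e) = k]. *)
    set (e := k / (2 + k)).
    assert (He : 0 < e) by (apply Rdiv_lt_0_compat; lra).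
    assert (He1 : e < 1) by (apply Rlt_div_l; lra).
    assert (Ek : 2 * e / (1 - e) = k) by (unfold e; field; lra).
    assert (Zero := nontangential_orbit_zero_step f tau z0 c f_holo f_self f_nt z0_disc
      (wolff_point_orbit f tau z0 tau_wolff z0_disc) Hc Hinf).
    destruct (zero_step_orbits_merge f f_self f_diff z0 w z0_disc Hw f_nofix Zero e He)
      as [N HN].
    exists (e * (1 - Cmod w)). split; [apply Rmult_lt_0_compat; lra|].
    exists N. intros n Hn z Kz Hz. apply Reduce.
    assert (X := pdist_iter_decr f f_self f_diff N n w z0 Hn Hw z0_disc).
    assert (Y := orbits_near_base_orbit f z0 w z e e n f_self f_diff z0_disc Hw (K_disc z Kz)
      He1 He1 ltac:(lra) ltac:(lra)).
    rewrite Ek in Y. fold (zeta n) in Y. apply Rle_lt_trans with (1 := Y).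
    assert (Pn := Pos n). assert (Hzn := Hzeta n). unfold unit_disc in Hzn.
    assert (Q : k * (1 + k) + k < eps) by nra.
    apply Rlt_le_trans with (eps * (1 - Cmod (zeta n)));
      [apply Rmult_lt_compat_r; lra|apply Rmult_le_compat_l; lra].
  (* The orbit of [z0] is tangential: a bounded distance to it is enough. *)
  - set (p := pdist w z0). assert (Hp : p < 1) by now apply pdist_lt_1.
    assert (Hp0 : 0 <= p) by apply pdist_ge_0.
    set (k := 2 * p / (1 - p)).
    assert (Hk : 0 <= k) by (apply Rdiv_le_0_compat; lra).
    exists ((1 / 2) * (1 - Cmod w)). split; [apply Rmult_lt_0_compat; lra|].
    set (A := 2 * (1 / 2) / (1 - 1 / 2) * (1 + k) + k).
    assert (HA : 0 < A) by (unfold A; lra).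
    assert (Hc : 0 < eps / A) by (apply Rdiv_lt_0_compat; lra).
    apply NNPP. intros No. apply Htan. exists (eps / A). split; [exact Hc|].
    intros N. apply NNPP. intros No'. apply No. exists N. intros n Hn z Kz Hz.
    apply Reduce.
    assert (Y := orbits_near_base_orbit f z0 w z (1 / 2) p n f_self f_diff z0_disc Hw
      (K_disc z Kz) ltac:(lra) Hp ltac:(lra) (pdist_iter_le f f_self f_diff n w z0 Hw z0_disc)).
    fold (zeta n) k A in Y. apply Rle_lt_trans with (1 := Y).
    assert (T : 1 - Cmod (zeta n) < eps / A * Cmod (tau - zeta n)%C).
    { apply Rnot_le_lt. intros H. apply No'. now exists n. }
    apply (Rmult_lt_compat_l A) in T; [|exact HA].
    replace (A * (eps / A * Cmod (tau - zeta n)%C)) with (eps * Cmod (tau - zeta n)%C) in T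
      by (field; lra).
    exact T.
Qed.
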